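(* Let $\mathfrak{g}=\mathfrak{sl}(3,\mathbb{C})$ and let $\phi:\mathfrak{g}\to\mathfrak{gl}(V(\lambda))$ be the irreducible finite-dimensional representation with highest weight $\lambda$. Let $\mu_1,\dots,\mu_s$ be the distinct dominant weights in the set $\Pi(\lambda)$ of weights of $V(\lambda)$, and let $k_i=|O_{\mu_i}|$ be the size of the $\mathscr{W}(\mathrm{A}_2)$-orbit of $\mu_i$. Then $$f_\phi(z_0,L)=\prod_{i=1}^s (f_{\mu_i})^{m_\lambda(\mu_i)},$$ where each orbital factor $f_{\mu_i}$ is an irreducible polynomial of degree $k_i$.
   Context: For a finite-dimensional representation $\phi$ of $\mathfrak{g}$, the characteristic polynomial is $f_\phi(z_0,L)=\det(z_0I+\phi(L))$, regarded as a polynomial in $z_0$ and the coordinates of $L\in\mathfrak{g}$ with respect to a Chevalley basis (e.g. $H_1=E_{11}-E_{22}$, $H_2=E_{22}-E_{33}$, $E_{ij}$ for $i\neq j$), equivalently a polynomial function on $\mathbb{C}\times\mathfrak{g}$. $\mathfrak{h}$ is the diagonal Cartan subalgebra, $\mathscr{W}(\mathrm{A}_2)\cong\mathfrak{S}_3$ the Weyl group acting on $\mathfrak{h}^*$, and $O_\mu=\mathscr{W}\mu$. $m_\lambda(\mu)$ is the multiplicity (dimension of the weight space) of $\mu$ in $V(\lambda)$. Orbital factor: for a dominant integral weight $\mu$ and a diagonalizable $L\in\mathfrak{g}$ with eigenvalues $\theta_1,\theta_2,\theta_3$, put $h=\mathrm{diag}(\theta_1,\theta_2,\theta_3)\in\mathfrak{h}$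 and $f_\mu(z_0,L)=\prod_{\nu\in O_\mu}(z_0+\nu(h))$; this is independent of the ordering of the eigenvalues and extends uniquely to a polynomial function on $\mathbb{C}\times\mathfrak{g}$, still denoted $f_\mu$. Irreducibility is in the polynomial ring in $z_0$ and the coordinates of $L$ over $\mathbb{C}$. *)

(* Defs.v *)
From HB Require Import structures.
From mathcomp Require Import all_boot all_order all_algebra all_fingroup.
From mathcomp Require Import mpoly.
Set Implicit Arguments. Unset Strict Implicit. Unset Printing Implicit Defensive.
Import Order.TTheory GRing.Theory Num.Theory.
Local Open Scope ring_scope.

Section SL3.
Variable C : numClosedFieldType.

Definition sl3 (L : 'M[C]_3) : Prop := \tr L = 0.

Definition i0 : 'I_3 := @Ordinal 3 0 isT.
Definition i1 : 'I_3 := @Ordinal 3 1 isT.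
Definition i2 : 'I_3 := @Ordinal 3 2 isT.

Definition H1 : 'M[C]_3 := delta_mx i0 i0 - delta_mx i1 i1.
Definition H2 : 'M[C]_3 := delta_mx i1 i1 - delta_mx i2 i2.
Definition chev (k : 'I_8) : 'M[C]_3 :=
  match val k with
  | 0 => H1
  | 1 => H2
  | 2 => delta_mx i0 i1
  | 3 => delta_mx i0 i2
  | 4 => delta_mx i1 i0
  | 5 => delta_mx i1 i2
  | 6 => delta_mx i2 i0
  | _ => delta_mx i2 i1
  end.

Definition sl3_of (x : 'I_8 -> C) : 'M[C]_3 := \sum_(k < 8) x k *: chev k.

Definition is_sl3_rep (n : nat) (phi : 'M[C]_3 -> 'M[C]_n) : Prop :=
  (forall (a : C) (L M : 'M[C]_3), sl3 L -> sl3 M ->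
     phi (a *: L + M) = a *: phi L + phi M) /\
  (forall L M : 'M[C]_3, sl3 L -> sl3 M ->
     phi (L *m M - M *m L) = phi L *m phi M - phi M *m phi L).

(* irreducible: nonzero and no invariant subspaces other than 0 and C^n.
   A subspace is the row space of U (its rows are the transposed vectors);
   invariance of the column vectors under phi L reads U *m (phi L)^T <= U. *)
Definition irreducible_rep (n : nat) (phi : 'M[C]_3 -> 'M[C]_n) : Prop :=
  (0 < n)%N /\
  forall U : 'M[C]_n,
    (forall L, sl3 L -> (U *m (phi L)^T <= U)%MS) ->
    U = 0 \/ row_full U.

(* A weight mu in h^* is encoded by (mu(H1), mu(H2)). *)
Definition weight := (C * C)%type.

(* value of the weight mu at h = diag(t 0, t 1, t 2) (t 0 + t 1 + t 2 = 0),
   using h = t0 H1 + (t0 + t1) H2 *)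
Definition wev (mu : weight) (t : 'I_3 -> C) : C :=
  mu.1 * t i0 + mu.2 * (t i0 + t i1).

Definition wmult (n : nat) (phi : 'M[C]_3 -> 'M[C]_n) (mu : weight) : nat :=
  \rank (kermx (phi H1 - mu.1%:M)^T :&: kermx (phi H2 - mu.2%:M)^T)%MS.

Definition highest_weight (n : nat) (phi : 'M[C]_3 -> 'M[C]_n) (lam : weight)
  : Prop :=
  exists v : 'cV[C]_n, v != 0 /\
    phi H1 *m v = lam.1 *: v /\ phi H2 *m v = lam.2 *: v /\
    phi (delta_mx i0 i1) *m v = 0 /\ phi (delta_mx i0 i2) *m v = 0 /\
    phi (delta_mx i1 i2) *m v = 0.

Definition dominant (mu : weight) : Prop :=
  exists a b : nat, mu = (a%:R, b%:R).

(* Weyl group W(A2) = S3 acting on h^* : (s.mu)(h) = mu(h with diagonal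
   entries permuted by s) *)
Definition weyl_act (s : 'S_3) (mu : weight) : weight :=
  (wev mu (fun i => H1 (s i) (s i)),
   wev mu (fun i => H2 (s i) (s i))).

Definition weyl_orbit (mu : weight) : seq weight :=
  undup [seq weyl_act s mu | s <- enum [set: 'S_3]].

(* f_phi(z0, L) = det(z0 I + phi(L)) as a polynomial in z0 (variable 0) and
   the Chevalley coordinates of L (variables 1..8) *)
Definition var (k : 'I_8) : 'I_9 := lift ord0 k.

Definition char_mpoly (n : nat) (phi : 'M[C]_3 -> 'M[C]_n) : {mpoly C[9]} :=
  \det ('X_ord0 *: (1%:M : 'M[{mpoly C[9]}]_n)
        + \sum_(k < 8) 'X_(var k) *: map_mx (fun c => c%:MP) (phi (chev k))).

Definition pt (z0 : C) (x : 'I_8 -> C) : 'I_9 -> C :=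
  fun i => match unlift ord0 i with None => z0 | Some k => x k end.

Definition orbital_factor (mu : weight) (p : {mpoly C[9]}) : Prop :=
  forall (z0 : C) (x : 'I_8 -> C) (theta : 'I_3 -> C) (P : 'M[C]_3),
    P \in unitmx ->
    sl3_of x = P *m diag_mx (\row_i theta i) *m invmx P ->
    p.@[pt z0 x] = \prod_(nu <- weyl_orbit mu) (z0 + wev nu theta).

Definition mirreducible (p : {mpoly C[9]}) : Prop :=
  p != 0 /\ p \isn't a GRing.unit /\
  forall q r : {mpoly C[9]}, p = q * r -> q \is a GRing.unit \/ r \is a GRing.unit.

Definition mdegree (p : {mpoly C[9]}) : nat := (msize p).-1.

End SL3.

(* Main.v *)
Require Import Defs.
From HB Require Import structures.
From mathcomp Require Import all_boot all_order all_algebra all_fingroup.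
From mathcomp Require Import mpoly.
From mathcomp Require Import ring zify.
Import Order.TTheory GRing.Theory Num.Theory.
Set Implicit Arguments. Unset Strict Implicit. Unset Printing Implicit Defensive.
Local Open Scope ring_scope.

(** Both sides of the factorization are polynomials, so it suffices to compare
    them at diagonalizable [L = P D P^-1].  Along a line of matrices through
    [1] and [P], Jacobi's formula for the derivative of a determinant turns the
    bracket relation into a linear differential equation, whence
    [det (z + phi (P D P^-1)) = det (z + phi D)].  By irreducibility the Cartan
    subalgebra acts diagonally and all weights lie in [lam + root lattice].
    Conjugating by permutation matrices shows that the multiset of weights is
    invariant under the Weyl group; as [s lam - lam] then lies in the root
    lattice, [lam] and all weights are integral, and grouping them into orbits
    gives the factorization.

    The orbital factors are explicit determinants, homogeneous of degree the
    size of the orbit.  If such a factor is [q r], substitute for [L] the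
    companion matrix with eigenvalues [t]: its root [- mu(t)] in [z0] is a root
    of [q], say, for all [t], and since the companion matrix is symmetric in
    [t], every [- nu(t)] with [nu] in the orbit of [mu] is a root of [q].
    Hence [q] has the degree of the product and [r] is constant. *)

(** * Polynomial functions over infinite domains *)

Section PolynomialFunctions.
Variable R : numDomainType.

(** Characteristic zero makes the first [size p + size B] numerals distinct; at most [size B] of
    them lie in the exceptional set [B], so at least [size p] of them are roots. *)
Lemma poly_infinite_roots (p : {poly R}) (B : seq R) :
  (forall x, x \notin B -> p.[x] = 0) -> p = 0.
Proof.
move=> pB; apply/eqP; apply: contraT => p0.
pose s := [seq (i%:R : R) | i <- iota 0 (size p + size B)].
have us : uniq s by rewrite map_inj_uniq ?iota_uniq // => i j /eqP; rewrite eqr_nat => /eqP.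
pose rs := [seq x <- s | x \notin B].
have /(max_poly_roots p0)/(_ (filter_uniq _ us)) : all (root p) rs.
  by apply/allP => x; rewrite mem_filter => /andP[/pB px _]; apply/rootP.
have : (size [seq x <- s | x \in B] <= size B)%N.
  apply: uniq_leq_size; first exact: filter_uniq.
  by move=> x; rewrite mem_filter => /andP[].
have := count_predC (fun x => x \in B) s; rewrite size_map size_iota.
rewrite !size_filter /=; set c1 := count _ _; set c2 := count _ _.
move=> e l1 l2; have := leq_add l1 l2.
by rewrite addnS e addnC ltnn.
Qed.

Lemma poly_eval_inj (p q : {poly R}) : (forall x, p.[x] = q.[x]) -> p = q.
Proof.
move=> pq; apply/subr0_eq/(@poly_infinite_roots _ [::]) => x _.
by rewrite hornerD hornerN pq subrr.
Qed.

(** A monomial is determined by its exponent in the last variable together with its restriction to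
    the others, so no cancellation can occur in [muni p]. *)
Lemma muni_inj0 n (p : {mpoly R[n.+1]}) : muni p = 0 -> p = 0.
Proof.
move=> p0; apply/mpolyP => m0; rewrite mcoeff0.
apply/eqP; rewrite mcoeff_eq0; apply: contraT; rewrite negbK => m0p.
pose res (m : 'X_{1..n.+1}) := [multinom m (widen_ord (leqnSn n) i) | i < n].
have := congr1 (fun q : {poly {mpoly R[n]}} => q`_(m0 ord_max)@_(res m0)) p0.
rewrite coef0 mcoeff0 muniE coef_sum raddf_sum /= (bigD1_seq m0) //=.
rewrite big1_seq ?addr0.
  rewrite !coefZ coefXn eqxx mulr1 mcoeffZ mcoeffX eqxx mulr1 => /eqP.
  by rewrite mcoeff_eq0 m0p.
move=> m /andP[neq _]; rewrite !coefZ coefXn.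
case: eqP => [e|_]; last by rewrite mulr0 mcoeff0.
rewrite mulr1 mcoeffZ mcoeffX; case: eqP => [e'|]; last by rewrite mulr0.
case/eqP: neq; apply/mnmP => i.
case: (unliftP ord_max i) => [j ->|->] //.
have /mnmP/(_ j) := e'; rewrite !mnmE.
by have -> : lift ord_max j = widen_ord (leqnSn n) j
  by apply/val_inj; rewrite /= /bump leqNgt ltn_ord.
Qed.

Lemma meval_muni n (p : {mpoly R[n.+1]}) (v : 'I_n.+1 -> R) :
  p.@[v] = (map_poly (meval (fun i => v (widen_ord (leqnSn n) i))) (muni p)).[v ord_max].
Proof.
rewrite muniE mevalE raddf_sum horner_sum; apply: eq_bigr => m _ /=.
rewrite map_polyZ map_polyXn /= hornerZ hornerXn.
rewrite mevalZ mevalX big_ord_recr /= mulrA; congr (_ * _ * _).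
by apply: eq_bigr => i _; rewrite mnmE.
Qed.

(** Induction on the number of variables: once the other variables have values, the polynomial in
    the last one has infinitely many roots, so every coefficient of [muni p] vanishes at every
    point. *)
Lemma meval_inj0 n (p : {mpoly R[n]}) : (forall v, p.@[v] = 0) -> p = 0.
Proof.
elim: n p => [|n IHn] p p0.
  have pE : p = (p@_0)%:MP.
    apply/mpolyP => m; rewrite mcoeffC.
    by have -> : m = 0%MM; [apply/mnmP; case|rewrite eqxx mulr1].
  by move: (p0 (fun=> 0)); rewrite pE mevalC => ->; rewrite mpolyC0.
apply: muni_inj0; apply/polyP => k; rewrite coef0; apply: IHn => v.
have : map_poly (meval v) (muni p) = 0.
  apply: (@poly_infinite_roots _ [::]) => x _.
  pose w (i : 'I_n.+1) := if unlift ord_max i is Some j then v j else x.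
  have /[!meval_muni] := p0 w.
  rewrite {2}/w unlift_none => <-; congr _.[_]; apply: eq_map_poly => q.
  apply: meval_eq => i; rewrite /w.
  have -> : widen_ord (leqnSn n) i = lift ord_max i
    by apply/val_inj; rewrite /= /bump leqNgt ltn_ord.
  by rewrite liftK.
by move/(congr1 (fun q : {poly R} => q`_k)); rewrite coef_map coef0.
Qed.

(** Lets the total degree of a polynomial bound the number of its roots along a line; this drives
    the degree count for irreducibility. *)
Lemma size_mmap_polyC n (h : 'I_n -> {poly R}) (p : {mpoly R[n]}) :
  (forall i, (size (h i) <= 2)%N) -> (size (mmap polyC h p) <= msize p)%N.
Proof.
move=> h2; rewrite /mmap; apply: (leq_trans (size_sum _ _ _)).
apply/bigmax_leqP_seq => m mp _; rewrite mul_polyC.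
apply: (leq_trans (size_scale_leq _ _)); apply: leq_trans (msize_mdeg_lt mp).
rewrite /mmap1 mdegE; elim/big_ind2: _ => [|q1 d1 q2 d2 s1 s2|i _].
- by rewrite size_poly1.
- apply: (leq_trans (size_polyMleq _ _)); lia.
apply: (leq_trans (size_poly_exp_leq _ _)).
by move: (h2 i); case: (size (h i)) => [|[|[]]] //=; rewrite ?mul1n.
Qed.

Lemma horner_mmap_polyC n (h : 'I_n -> {poly R}) (p : {mpoly R[n]}) x :
  (mmap polyC h p).[x] = p.@[fun i => (h i).[x]].
Proof.
rewrite /mmap mevalE horner_sum; apply: eq_bigr => m _.
rewrite hornerM hornerC /mmap1 horner_prod; congr (_ * _).
by apply: eq_bigr => i _; rewrite horner_exp.
Qed.

End PolynomialFunctions.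

(** * Density of diagonalizable matrices *)

Lemma ord3P (i : 'I_3) : [\/ i = i0, i = i1 | i = i2].
Proof.
by case: i => -[|[|[|//]]] lt_i;
  [apply: Or31|apply: Or32|apply: Or33]; apply: val_inj.
Qed.

Lemma sum3E (V : nmodType) (F : 'I_3 -> V) : \sum_i F i = F i0 + F i1 + F i2.
Proof.
by rewrite !big_ord_recr big_ord0 /= add0r; congr (F _ + F _ + F _); apply: val_inj.
Qed.

Lemma trace3E (R : pzSemiRingType) (M : 'M[R]_3) : \tr M = M i0 i0 + M i1 i1 + M i2 i2.
Proof. exact: sum3E. Qed.

(** The diagonal coordinates come from diag(t0, t1, t2) = t0 H1 + (t0 + t1) H2 for trace zero. The
    entries are general so that matrices of polynomials are covered too. *)
Definition chev_coord (R : nmodType) (M : 'M[R]_3) (k : 'I_8) : R :=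
  match val k with
  | 0 => M i0 i0
  | 1 => M i0 i0 + M i1 i1
  | 2 => M i0 i1
  | 3 => M i0 i2
  | 4 => M i1 i0
  | 5 => M i1 i2
  | 6 => M i2 i0
  | _ => M i2 i1
  end.

Section Density.
Variable C : numClosedFieldType.

Lemma sl3_ofK (M : 'M[C]_3) : \tr M = 0 -> sl3_of (chev_coord M) = M.
Proof.
rewrite trace3E => trM; have M22 : M i2 i2 = - (M i0 i0 + M i1 i1) by rewrite -(addr0_eq trM).
rewrite /sl3_of !big_ord_recr big_ord0 /= add0r /chev /chev_coord /= /H1 /H2.
apply/matrixP => i j.
by case: (ord3P i) => ->; case: (ord3P j) => ->; rewrite !mxE /= ?M22; ring.
Qed.

Lemma chev_tr0 (k : 'I_8) : \tr (chev C k) = 0.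
Proof.
case: k => -[|[|[|[|[|[|[|[|//]]]]]]]] lt_k;
  by rewrite trace3E /chev /= /H1 /H2 !mxE /=; ring.
Qed.

Lemma sl3_of_tr0 (x : 'I_8 -> C) : \tr (sl3_of x) = 0.
Proof.
rewrite /sl3_of raddf_sum big1 // => k _.
by rewrite /= mxtraceZ chev_tr0 mulr0.
Qed.

Lemma sl3_ofD_coord (x : 'I_8 -> C) c (M : 'M[C]_3) : \tr M = 0 ->
  sl3_of (fun k => x k + c * chev_coord M k) = sl3_of x + c *: M.
Proof.
move=> trM; rewrite -{2}(sl3_ofK trM) /sl3_of scaler_sumr -big_split /=.
by apply: eq_bigr => k _; rewrite scalerDl scalerA.
Qed.

(** The minimal polynomial divides the characteristic one, which has the distinct diagonal entries
    as simple roots. *)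
Lemma trig_diagonalizable n (T : 'M[C]_n.+1) :
  is_trig_mx T -> injective (fun i => T i i) ->
  exists P : 'M[C]_n.+1, P \in unitmx /\ exists d, T = P *m diag_mx d *m invmx P.
Proof.
move=> trT injT.
have [P Pu] : diagonalizable T.
  apply/diagonalizableP; exists [seq T i i | i <- enum 'I_n.+1].
    by rewrite map_inj_uniq ?enum_uniq.
  apply: dvdp_trans (mxminpoly_dvd_char T) _.
  by rewrite char_poly_trig // big_map big_enum.
move=> /similar_diagPex[d /(similarLR Pu) eT].
exists (invmx P); rewrite unitmx_inv; split => //; exists d.
by rewrite eT conjumx ?unitmx_inv.
Qed.

(** Every point lies on a line with only finitely many exceptions to diagonalizability:
    triangularize by Schur and add multiples of the traceless matrix diag(0, 1, -1). Then [p - q]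
    vanishes on the whole line, in particular at the given point. *)
Lemma eq_on_diagonalizable (p q : {mpoly C[9]}) :
  (forall z x (theta : 'I_3 -> C) P, P \in unitmx ->
     sl3_of x = P *m diag_mx (\row_i theta i) *m invmx P ->
     p.@[pt z x] = q.@[pt z x]) ->
  p = q.
Proof.
move=> pq; apply/subr0_eq/meval_inj0 => v.
pose x k := v (var k).
have [P /unitarymx_unit Pu] := Schur (sl3_of x) (isT : 0 < 3)%N.
rewrite /similar_to conjumx // => trT.
set T := P *m _ *m _ in trT.
pose E : 'M[C]_3 := diag_mx (\row_i (if i == i1 then 1 else if i == i2 then - 1 else 0)).
pose M := invmx P *m E *m P.
have trM : \tr M = 0.
  by rewrite /M mxtrace_mulC mulmxA mulmxV // mul1mx trace3E !mxE /=; ring.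
(* The values of [c] at which two of the diagonal entries [T i0 i0], [T i1 i1 + c], [T i2 i2 - c]
   coincide. *)
pose B := [:: T i0 i0 - T i1 i1; T i2 i2 - T i0 i0; (T i2 i2 - T i1 i1) / 2].
pose h (i : 'I_9) : {poly C} := (v i)%:P +
  (if unlift ord0 i is Some k then chev_coord M k else 0) *: 'X.
have : mmap polyC h (p - q) = 0.
  apply: (@poly_infinite_roots _ _ B) => c cB.
  rewrite horner_mmap_polyC.
  pose y k := x k + c * chev_coord M k.
  rewrite (@meval_eq _ _ _ (pt (v ord0) y)); last first.
    move=> i; rewrite /h /pt hornerD hornerC hornerZ hornerX.
    case: (unliftP ord0 i) => [k ->|->] /=; last by rewrite mul0r addr0.
    by rewrite /y mulrC.
  have TE : T + c *: E = P *m sl3_of y *m invmx P.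
    rewrite sl3_ofD_coord // mulmxDr mulmxDl; congr (_ + _).
    rewrite /M -scalemxAr -scalemxAl; congr (_ *: _).
    by rewrite !mulmxA mulmxV // mul1mx -mulmxA mulmxV // mulmx1.
  have trTE : is_trig_mx (T + c *: E).
    apply/is_trig_mxP => i j lt_ij; rewrite mxE (is_trig_mxP trT) // !mxE.
    by rewrite (_ : (i == j) = false) ?mulr0n ?mulr0 ?addr0 //; apply/eqP => eij;
       rewrite eij ltnn in lt_ij.
  have [|Q [Qu [d eQ]]] := trig_diagonalizable trTE.
    have two0 : (2 : C) != 0 by rewrite pnatr_eq0.
    have E00 : (T + c *: E) i0 i0 = T i0 i0 by rewrite !mxE /= mulr0 addr0.
    have E11 : (T + c *: E) i1 i1 = T i1 i1 + c by rewrite !mxE /= mulr1.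
    have E22 : (T + c *: E) i2 i2 = T i2 i2 - c by rewrite !mxE /= mulrN mulr1.
    move: cB; rewrite !inE !negb_or => /and3P[c1 c2 c3].
    have n01 : T i0 i0 != T i1 i1 + c by apply: contraNneq c1 => ->; apply/eqP; ring.
    have n02 : T i0 i0 != T i2 i2 - c by apply: contraNneq c2 => ->; apply/eqP; ring.
    have n12 : T i1 i1 + c != T i2 i2 - c.
      apply: contraNneq c3 => e; apply/eqP/(mulIf two0); rewrite mulfVK //.
      by rewrite -[T i2 i2](subrK c) -e; ring.
    move=> i j; case: (ord3P i) => ->; case: (ord3P j) => ->;
      rewrite ?E00 ?E11 ?E22 //; move/eqP;
      rewrite ?[_ == T i0 i0]eq_sym ?(negPf n01) ?(negPf n02) ?(negPf n12) //.
    by rewrite eq_sym (negPf n12).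
  have Su : invmx P *m Q \in unitmx by rewrite unitmx_mul unitmx_inv Pu.
  have yE : sl3_of y = (invmx P *m Q) *m diag_mx d *m invmx (invmx P *m Q).
    have -> : sl3_of y = invmx P *m (T + c *: E) *m P.
      by rewrite TE !mulmxA mulVmx // mul1mx -mulmxA mulVmx // mulmx1.
    apply: (canRL (mulmxK Su)).
    by rewrite eQ -!mulmxA mulKVmx // mulVmx // mulmx1.
  rewrite mevalB (pq _ _ (fun i => d 0 i) (invmx P *m Q)) ?subrr //.
  by rewrite yE; congr (_ *m diag_mx _ *m _); apply/rowP => i; rewrite mxE.
move/(congr1 (fun r => r.[0])); rewrite horner_mmap_polyC horner0 => <-.
by apply: meval_eq => i; rewrite /h hornerD hornerC hornerZ hornerX mulr0 addr0.
Qed.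

End Density.

(** * Invariance of det (z + phi L) under conjugation *)

Section Jacobi.
Variable R : comNzRingType.

Lemma deriv_prod n (F : 'I_n -> {poly R}) :
  (\prod_i F i)^`() = \sum_i \prod_j (if j == i then (F j)^`() else F j).
Proof.
elim: n F => [|n IHn] F; first by rewrite !big_ord0 derivC.
rewrite big_ord_recl derivM IHn [RHS]big_ord_recl; congr (_ + _).
  by rewrite big_ord_recl eqxx.
rewrite mulr_sumr; apply: eq_bigr => i _; rewrite [RHS]big_ord_recl /=.
by congr (_ * _); apply: eq_bigr => j _; rewrite (inj_eq lift_inj).
Qed.

(** Jacobi's formula: by the product rule the derivative is the sum over [i] of the determinants
    with row [i] differentiated, and expanding along that row leaves the cofactors of [B] itself. *)
Lemma deriv_det n (B : 'M[{poly R}]_n) :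
  (\det B)^`() = \tr (map_mx (@deriv R) B *m \adj B).
Proof.
pose rep i := \matrix_(j, k) (if j == i then (B j k)^`() else B j k).
transitivity (\sum_i \det (rep i)).
  rewrite /determinant raddf_sum exchange_big; apply: eq_bigr => s _ /=.
  rewrite -signr_odd mulr_sign; case: ifP => _; rewrite ?derivN deriv_prod ?sumrN.
    by rewrite -sumrN; apply: eq_bigr => i _; rewrite expr1 mulN1r; congr (- _);
       apply: eq_bigr => j _; rewrite mxE.
  by apply: eq_bigr => i _; rewrite expr0 mul1r; apply: eq_bigr => j _; rewrite mxE.
apply: eq_bigr => i _; rewrite (expand_det_row _ i) mxE.
apply: eq_bigr => j _; rewrite !mxE eqxx /cofactor; congr (_ * (_ * \det _)).
by apply/matrixP => k l; rewrite !mxE eq_sym (negPf (neq_lift _ _)).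
Qed.

Lemma map_deriv_mulmx m n p (A : 'M[{poly R}]_(m, n)) (B : 'M_(n, p)) :
  map_mx (@deriv R) (A *m B) =
  map_mx (@deriv R) A *m B + A *m map_mx (@deriv R) B.
Proof.
apply/matrixP => i j; rewrite !mxE raddf_sum -big_split /=.
by apply: eq_bigr => k _; rewrite derivM !mxE.
Qed.

End Jacobi.

(** * First-order linear differential equations for polynomials *)

Section LinearODE.
Variable F : numFieldType.

(** If the coefficients of [u] vanish up to index [k], comparing coefficients of index [k] leaves
    [d_0 (k + 1) u_(k+1) = 0]. *)
Lemma poly_ode_eq0 (d c u : {poly F}) :
  d.[0] != 0 -> u.[0] = 0 -> d * u^`() = c * u -> u = 0.
Proof.
rewrite !horner_coef0 => d0 u0 ode.
suff H k : forall j, (j <= k)%N -> u`_j = 0.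
  by apply/polyP => k; rewrite coef0 (H k).
elim: k => [j|k IHk j]; first by rewrite leqn0 => /eqP->.
rewrite leq_eqVlt => /orP[/eqP->|]; last exact: IHk.
move/(congr1 (fun p : {poly F} => p`_k)): ode; rewrite !coefM.
rewrite [RHS]big1 => [|i _]; last by rewrite IHk ?mulr0 // leq_subr.
rewrite big_ord_recl subn0 coef_deriv big1 ?addr0 => [/eqP|i _].
  by rewrite mulf_eq0 (negPf d0) /= mulrn_eq0 /= => /eqP.
rewrite coef_deriv IHk ?mul0rn ?mulr0 //= /bump /=; case: i => i /=; lia.
Qed.

(** The power [d ^+ n] solves the same equation, so its multiple with the same value at 0 differs
    from [g] by a solution vanishing at 0. *)
Lemma poly_ode_exp (d g : {poly F}) n :
  d.[0] = 1 -> d * g^`() = (d^`() *+ n) * g -> g = g.[0] *: d ^+ n.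
Proof.
move=> d0 ode; apply/subr0_eq/(@poly_ode_eq0 d (d^`() *+ n)).
- by rewrite d0 oner_eq0.
- by rewrite hornerD hornerN hornerZ horner_exp d0 expr1n mulr1 subrr.
rewrite derivB derivZ deriv_exp mulrBr ode mulrBr; congr (_ - _).
case: n {ode} => [|n]; first by rewrite !mulr0n mul0r scaler0 mulr0.
by rewrite -scalerAr -[in RHS]scalerAr; congr (_ *: _); rewrite /= exprS; ring.
Qed.

End LinearODE.

(** * Transport of the determinant along a line of matrices *)

Section Conjugation.
Variables (C : numClosedFieldType) (n : nat) (phi : 'M[C]_3 -> 'M[C]_n).
Hypothesis rep : is_sl3_rep phi.

Lemma rep0 : phi 0 = 0.
Proof.
have tr0 : sl3 (0 : 'M[C]_3) by rewrite /sl3 mxtrace0.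
have := rep.1 (-1) _ _ tr0 tr0.
by rewrite scaler0 addr0 scaleN1r addNr.
Qed.

Lemma repD L M : \tr L = 0 -> \tr M = 0 -> phi (L + M) = phi L + phi M.
Proof. by move=> trL trM; have := rep.1 1 _ _ trL trM; rewrite !scale1r. Qed.

Lemma repZ a L : \tr L = 0 -> phi (a *: L) = a *: phi L.
Proof.
move=> trL; have tr0 : sl3 (0 : 'M[C]_3) by rewrite /sl3 mxtrace0.
by have := rep.1 a _ _ trL tr0; rewrite !addr0 rep0 addr0.
Qed.

Lemma rep_sl3_of (x : 'I_8 -> C) : phi (sl3_of x) = \sum_k x k *: phi (chev C k).
Proof.
suff [] : phi (sl3_of x) = \sum_k x k *: phi (chev C k) /\ \tr (sl3_of x) = 0 by [].
rewrite /sl3_of; elim/big_ind2: _ => [|L1 A1 L2 A2 [e1 t1] [e2 t2]|k _].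
- by rewrite rep0 mxtrace0.
- by rewrite repD // e1 e2 mxtraceD t1 t2 addr0.
- by rewrite repZ ?mxtraceZ chev_tr0 ?mulr0.
Qed.

Lemma rep_bracket L M : \tr L = 0 -> \tr M = 0 ->
  phi (L *m M - M *m L) = phi L *m phi M - phi M *m phi L.
Proof. exact: rep.2. Qed.

(* Extension of scalars; only meaningful on traceless matrices, since
   [chev_coord] ignores the last diagonal entry. *)
Let phiP (M : 'M[{poly C}]_3) : 'M[{poly C}]_n :=
  \sum_k chev_coord M k *: map_mx polyC (phi (chev C k)).

Let ev m p t : 'M[{poly C}]_(m, p) -> 'M[C]_(m, p) := map_mx (horner_eval t).

Let ev_inj m p (A B : 'M[{poly C}]_(m, p)) : (forall t, ev t A = ev t B) -> A = B.
Proof.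
move=> AB; apply/matrixP => i j; apply: poly_eval_inj => t.
by have /matrixP/(_ i j) := AB t; rewrite !mxE.
Qed.

Let ev_phiP t (M : 'M[{poly C}]_3) : \tr M = 0 -> ev t (phiP M) = phi (ev t M).
Proof.
move=> trM; have trM' : \tr (ev t M) = 0 by rewrite /ev trace_map_mx trM rmorph0.
rewrite -(sl3_ofK trM') rep_sl3_of /ev /phiP raddf_sum; apply: eq_bigr => k _ /=.
apply/matrixP => i j; rewrite !mxE /= /horner_eval hornerM hornerC; congr (_ * _).
rewrite /chev_coord; case: k => -[|[|[|[|[|[|[|]]]]]]] //=; by rewrite !mxE ?hornerD.
Qed.

Let coordD k (M N : 'M[{poly C}]_3) : chev_coord (M + N) k = chev_coord M k + chev_coord N k.
Proof. by rewrite /chev_coord; case: k => -[|[|[|[|[|[|[|]]]]]]] //= ?; rewrite !mxE // addrACA. Qed.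

Let coordZ k a (M : 'M[{poly C}]_3) : chev_coord (a *: M) k = a * chev_coord M k.
Proof. by rewrite /chev_coord; case: k => -[|[|[|[|[|[|[|]]]]]]] //= ?; rewrite !mxE // mulrDr. Qed.

Let phiPD M N : phiP (M + N) = phiP M + phiP N.
Proof. by rewrite /phiP -big_split; apply: eq_bigr => k _ /=; rewrite coordD scalerDl. Qed.

Let phiPZ a M : phiP (a *: M) = a *: phiP M.
Proof. by rewrite /phiP scaler_sumr; apply: eq_bigr => k _ /=; rewrite coordZ scalerA. Qed.

Let phiP_deriv M : map_mx (@deriv C) (phiP M) = phiP (map_mx (@deriv C) M).
Proof.
rewrite /phiP raddf_sum; apply: eq_bigr => k _ /=.
apply/matrixP => i j; rewrite !mxE derivM derivC mulr0 addr0; congr (_ * _).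
by rewrite /chev_coord; case: k => -[|[|[|[|[|[|[|]]]]]]] //= ?; rewrite !mxE // derivD.
Qed.

Let phiP_bracket M N : \tr M = 0 -> \tr N = 0 ->
  phiP (M *m N - N *m M) = phiP M *m phiP N - phiP N *m phiP M.
Proof.
move=> trM trN; apply: ev_inj => t; rewrite ev_phiP; last first.
  by rewrite raddfB /= [X in X - _]mxtrace_mulC subrr.
have trM' : \tr (ev t M) = 0 by rewrite /ev trace_map_mx trM rmorph0.
have trN' : \tr (ev t N) = 0 by rewrite /ev trace_map_mx trN rmorph0.
by rewrite /ev !map_mxB !map_mxM /= -!/(ev _ _) !ev_phiP // rep_bracket.
Qed.

(* The curve [1 + t (P - 1)] may leave [GL_3], so the conjugate is multiplied
   by the determinant [d] of the curve; [det B] then solves [d g' = n d' g]. *)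
Lemma det_rep_conj z (L P : 'M[C]_3) : \tr L = 0 -> P \in unitmx ->
  \det (z%:M + phi (P *m L *m invmx P)) = \det (z%:M + phi L).
Proof.
move=> trL Pu.
pose Pt : 'M[{poly C}]_3 := 1%:M + 'X *: map_mx polyC (P - 1%:M).
pose Q := \adj Pt; pose d := \det Pt.
pose N := Pt *m map_mx polyC L *m Q.
pose Y := map_mx (@deriv C) Pt *m Q.
(* [Y] is [d] times the logarithmic derivative of the curve and has trace [d'] by Jacobi's formula.
   Subtracting a third of the trace puts it in sl3 without changing commutators. *)
pose Y0 := Y - (3^-1%:P * d^`())%:M.
pose B := (z%:P * d)%:M + phiP N.
have trN : \tr N = 0.
  rewrite /N mxtrace_mulC mulmxA mul_adj_mx mul_scalar_mx mxtraceZ.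
  by rewrite trace_map_mx trL rmorph0 mulr0.
have trY0 : \tr Y0 = 0.
  rewrite raddfB /= -deriv_det -/d mxtrace_scalar -mulrnAl -polyCMn.
  by rewrite -[3^-1 *+ 3]mulr_natl mulfV ?pnatr_eq0 // mul1r subrr.
(* Differentiate [Q *m Pt = d] and multiply by [Q] on the right; no inverse of [Pt] is needed. *)
have dQ : d *: map_mx (@deriv C) Q = d^`() *: Q - Q *m Y.
  have : map_mx (@deriv C) (Q *m Pt) = map_mx (@deriv C) d%:M by rewrite mul_adj_mx.
  rewrite map_deriv_mulmx => e.
  have {}e : map_mx (@deriv C) Q *m Pt = d^`()%:M - Q *m map_mx (@deriv C) Pt.
    rewrite -(addrK (Q *m map_mx (@deriv C) Pt) (_ *m Pt)) e; congr (_ - _).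
    by apply/matrixP => i j; rewrite !mxE; case: eqP => _; rewrite ?mulr1n ?mulr0n ?deriv0.
  have := congr1 (mulmx^~ Q) e; rewrite -mulmxA mul_mx_adj mulmxBl mul_scalar_mx.
  by rewrite mul_mx_scalar mulmxA.
have dN : d *: map_mx (@deriv C) N = Y0 *m N - N *m Y0 + d^`() *: N.
  have -> : Y0 *m N - N *m Y0 = Y *m N - N *m Y.
    rewrite /Y0 mulmxBl mulmxBr mul_scalar_mx mul_mx_scalar.
    by rewrite opprB addrA subrK.
  have cL : map_mx (@deriv C) (map_mx polyC L) = 0.
    by apply/matrixP => i j; rewrite !mxE derivC.
  rewrite /N map_deriv_mulmx map_deriv_mulmx cL mulmx0 addr0 scalerDr.
  rewrite [in X in _ + X = _]scalemxAr dQ.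
  rewrite mulmxBr -scalemxAr -/N addrA addrAC !mulmxA -/N; congr (_ - _ + _).
  rewrite /Y -!mulmxA (mulmxA Q) mul_adj_mx.
  by rewrite mul_scalar_mx -!scalemxAr.
(* The representation turns the commutator with [Y0] into the commutator with [phiP Y0], and the
   scalar part of [B] commutes with everything. *)
have dB : d *: map_mx (@deriv C) B =
    phiP Y0 *m B - B *m phiP Y0 + d^`() *: B.
  rewrite /B map_mxD scalerDr phiP_deriv -phiPZ dN phiPD phiPZ phiP_bracket //.
  rewrite mulmxDr mulmxDl mul_scalar_mx mul_mx_scalar scalerDr.
  rewrite opprD [X in _ = X + _]addrACA subrr add0r [RHS]addrCA; congr (_ + _).
  apply/matrixP => i j; rewrite !mxE; case: eqP => _.
    by rewrite !mulr1n /= derivM derivC mul0r add0r; ring.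
  by rewrite !mulr0n /= deriv0 !mulr0.
(* In Jacobi's formula the commutator contributes trace zero because [B] commutes with its adjugate;
   what remains is [d'] times the trace of the scalar matrix [\det B]. *)
have ode : d * (\det B)^`() = (d^`() *+ n) * \det B.
  rewrite deriv_det -mxtraceZ scalemxAl dB mulmxDl mulmxBl mxtraceD raddfB /=.
  rewrite -mulmxA mul_mx_adj [\tr (B *m _ *m _)]mxtrace_mulC mulmxA mul_adj_mx.
  rewrite mul_mx_scalar mul_scalar_mx.
  rewrite subrr add0r -scalemxAl mul_mx_adj mxtraceZ mxtrace_scalar.
  by rewrite mulrnAl mulrnAr.
have evM m k l t (A1 : 'M_(m, k)) (A2 : 'M_(k, l)) : ev t (A1 *m A2) = ev t A1 *m ev t A2.
  exact: map_mxM.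
have evdet k t (A : 'M_k) : (\det A).[t] = \det (ev t A).
  by rewrite /ev det_map_mx.
have evP t : ev t Pt = 1%:M + t *: (P - 1%:M).
  apply/matrixP => i j; rewrite !mxE /horner_eval hornerD hornerM hornerX hornerC.
  by congr (_ + _); case: eqP; rewrite ?hornerC ?horner0.
have evQ t : ev t Q = \adj (ev t Pt) by rewrite /ev map_mx_adj.
have evL t : ev t (map_mx polyC L) = L.
  by apply/matrixP => i j; rewrite !mxE /horner_eval hornerC.
have evB t : ev t B = (z * \det (ev t Pt))%:M + phi (ev t Pt *m L *m \adj (ev t Pt)).
  have -> : ev t B = ev t (z%:P * d)%:M + ev t (phiP N) by exact: map_mxD.
  rewrite ev_phiP // /N !evM evL evQ; congr (_ + _).
  by rewrite /ev map_scalar_mx /= /horner_eval hornerM hornerC evdet.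
have e0 : ev 0 Pt = 1%:M by rewrite evP scale0r addr0.
have e1 : ev 1 Pt = P by rewrite evP scale1r addrC subrK.
have d0 : d.[0] = 1 by rewrite evdet e0 det1.
have detP : \det P != 0 by move: Pu; rewrite unitmxE unitfE.
(* At 0 the matrix [B] is [z + phi L]; at 1 it is [\det P] times [z + phi (P L P^-1)]. The factor
   [\det P ^+ n] then appears on both sides and cancels. *)
have := congr1 (horner^~ 1) (poly_ode_exp d0 ode).
rewrite hornerZ horner_exp !evdet !evB e0 e1 det1 mulr1 mul1mx.
have -> : \adj (1%:M : 'M[C]_3) = 1%:M by rewrite -[LHS]mul1mx mul_mx_adj det1.
have -> : \adj P = \det P *: invmx P.
  by rewrite /invmx Pu scalerA mulfV // scale1r.
rewrite mulmx1 -scalemxAr repZ; last by rewrite mxtrace_mulC mulmxA mulVmx // mul1mx.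
rewrite mulrC -scale_scalar_mx -scalerDr detZ [RHS]mulrC => /mulfI; apply.
by rewrite expf_neq0.
Qed.

End Conjugation.

(** * Weights *)

Lemma perm_map_inj_in (T1 T2 : eqType) (f : T1 -> T2) (s1 s2 : seq T1) :
  {in s1 ++ s2 &, injective f} -> perm_eq (map f s1) (map f s2) -> perm_eq s1 s2.
Proof.
case: s1 => [|x0 s1'].
  by move=> _ /perm_size; rewrite size_map; case: s2.
set s1 := x0 :: s1' => finj.
pose g y := nth x0 (s1 ++ s2) (index y (map f (s1 ++ s2))).
have gK x : x \in s1 ++ s2 -> g (f x) = x.
  move=> xs; have fxs : f x \in map f (s1 ++ s2) by apply: map_f.
  have lt_i : (index (f x) (map f (s1 ++ s2)) < size (s1 ++ s2))%N.
    by rewrite -(size_map f) index_mem.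
  by apply: finj => //; [apply: mem_nth|rewrite -(nth_map x0 (f x)) // nth_index].
move=> /(perm_map g); rewrite -!map_comp !map_id_in //= => x xs; apply: gK.
  by rewrite mem_cat xs orbT.
by rewrite mem_cat xs.
Qed.

Lemma exists_notin (R : numDomainType) (B : seq R) : exists c, c \notin B.
Proof.
pose s := [seq (i%:R : R) | i <- iota 0 (size B).+1].
have us : uniq s by rewrite map_inj_uniq ?iota_uniq // => i j /eqP; rewrite eqr_nat => /eqP.
have /allPn[c _ cB] : ~~ all (mem B) s.
  by apply/allP => /(uniq_leq_size us); rewrite size_map size_iota ltnn.
by exists c.
Qed.

Lemma row_free_rowsub (F : fieldType) m n (f : 'I_m -> 'I_n) (P : 'M[F]_n) :
  injective f -> P \in unitmx -> row_free (rowsub f P).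
Proof.
move=> finj Pu; have -> : rowsub f P = rowsub f 1%:M *m P by rewrite mul_rowsub_mx mul1mx.
rewrite /row_free mxrankMfree ?row_free_unit //; apply/row_freeP.
exists (rowsub f 1%:M)^T; rewrite mul_rowsub_mx mul1mx.
by apply/matrixP => i j; rewrite !mxE eq_sym (inj_eq finj).
Qed.

Section Weights.
Variable C : numClosedFieldType.

(** At [theta = (1, c - 1, - c)] the weight [(a, b)] takes the value [a + b c], and two distinct
    weights agree there for at most one [c]. *)
Lemma generic_theta (s : seq (weight C)) :
  exists2 theta : 'I_3 -> C,
    theta i0 + theta i1 + theta i2 = 0 & {in s &, injective (fun nu => wev nu theta)}.
Proof.
have [c cB] := exists_notin
  [seq - (nu.1.1 - nu.2.1) / (nu.1.2 - nu.2.2) | nu <- [seq (a, b) | a <- s, b <- s]].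
exists (fun i => if i == i0 then 1 else if i == i1 then c - 1 else - c).
  by rewrite /=; ring.
move=> [a1 a2] [b1 b2] sa sb; rewrite /wev /= => e.
have e' : (a1 - b1) + (a2 - b2) * c = 0.
  transitivity ((a1 * 1 + a2 * (1 + (c - 1))) - (b1 * 1 + b2 * (1 + (c - 1)))).
    by ring.
  by rewrite e subrr.
case: (eqVneq a2 b2) => [e2|ne2].
  by rewrite e2 subrr mul0r addr0 in e'; rewrite e2 (subr0_eq e').
case/negP: cB; apply/mapP; exists ((a1, a2), (b1, b2)) => /=.
  by apply/allpairsP; exists ((a1, a2), (b1, b2)).
have d0 : a2 - b2 != 0 by rewrite subr_eq0.
by apply: (mulIf d0); rewrite mulfVK // mulrC -[RHS]add0r -e'; ring.
Qed.

(** [weyl_act] records values at [H1] and [H2] only, and these span the traceless diagonal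
    matrices. *)
Lemma wev_weyl (mu : weight C) s (t : 'I_3 -> C) : t i0 + t i1 + t i2 = 0 ->
  wev (weyl_act s mu) t = wev mu (fun i => t (s i)).
Proof.
move=> t0.
have tE i : t i = t i0 * H1 C i i + (t i0 + t i1) * H2 C i i.
  have t2 : t i2 = - (t i0 + t i1) by rewrite -(addr0_eq t0).
  by case: (ord3P i) => ->; rewrite !mxE /= ?t2; ring.
rewrite /weyl_act /wev /= (tE (s i0)) (tE (s i1)); ring.
Qed.

(* Coordinates of the root of [chev k] on the simple roots [(2, -1)] and [(-1, 2)]. *)
Definition root_coord (k : 'I_8) : int * int :=
  match val k with
  | 2 => (1, 0)%Z
  | 3 => (1, 1)%Z
  | 4 => (-1, 0)%Z
  | 5 => (0, 1)%Z
  | 6 => (-1, -1)%Z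
  | 7 => (0, -1)%Z
  | _ => (0, 0)%Z
  end.

(** The value of the root at [H1], read off the Cartan matrix; it is zero for the two Cartan
    elements. *)
Definition root_ev1 k : C := 2 * (root_coord k).1%:~R - (root_coord k).2%:~R.
Definition root_ev2 k : C := 2 * (root_coord k).2%:~R - (root_coord k).1%:~R.

Lemma bracket_H1 k : H1 C *m chev C k - chev C k *m H1 C = root_ev1 k *: chev C k.
Proof.
apply/matrixP => i j; case: k => -[|[|[|[|[|[|[|[|//]]]]]]]] lt_k;
case: (ord3P i) => ->; case: (ord3P j) => ->;
by rewrite /root_ev1 /chev /root_coord /= /H1 /H2 !mxE !sum3E !mxE /=; ring.
Qed.

Lemma bracket_H2 k : H2 C *m chev C k - chev C k *m H2 C = root_ev2 k *: chev C k.
Proof.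
apply/matrixP => i j; case: k => -[|[|[|[|[|[|[|[|//]]]]]]]] lt_k;
case: (ord3P i) => ->; case: (ord3P j) => ->;
by rewrite /root_ev2 /chev /root_coord /= /H1 /H2 !mxE !sum3E !mxE /=; ring.
Qed.

Lemma tr_H1 : \tr (H1 C) = 0.
Proof. by rewrite trace3E !mxE /=; ring. Qed.

Lemma tr_H2 : \tr (H2 C) = 0.
Proof. by rewrite trace3E !mxE /=; ring. Qed.

Lemma diag_H1H2 (t : 'I_3 -> C) : t i0 + t i1 + t i2 = 0 ->
  diag_mx (\row_i t i) = t i0 *: H1 C + (t i0 + t i1) *: H2 C.
Proof.
move=> t0; have t2 : t i2 = - (t i0 + t i1) by rewrite -(addr0_eq t0).
by apply/matrixP => i j; case: (ord3P i) => ->; case: (ord3P j) => ->;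
  rewrite !mxE /= ?t2; ring.
Qed.

Variables (n : nat) (phi : 'M[C]_3 -> 'M[C]_n).
Hypothesis rep : is_sl3_rep phi.
Hypothesis irr : irreducible_rep phi.

Lemma irr_chev (U : 'M[C]_n) :
  (forall k, (U *m (phi (chev C k))^T <= U)%MS) -> U = 0 \/ row_full U.
Proof.
move=> Uk; apply: irr.2 => L trL; rewrite -(sl3_ofK trL) rep_sl3_of //.
rewrite raddf_sum mulmx_sumr; apply: summx_sub => k _ /=.
by rewrite linearZ /= -scalemxAr scalemx_sub.
Qed.

(** Vectors are rows here. Transposition reverses products, so a row eigenvector of [(phi H)^T] for
    [a] is sent by [(phi (chev C k))^T] into the eigenspace for [a + r], with the sign of the root
    kept. *)
Lemma rep_tr_bracket (H : 'M[C]_3) k r : \tr H = 0 ->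
  H *m chev C k - chev C k *m H = r *: chev C k ->
  (phi (chev C k))^T *m (phi H)^T - (phi H)^T *m (phi (chev C k))^T =
  r *: (phi (chev C k))^T.
Proof.
move=> trH e; rewrite -linearZ /= -repZ ?chev_tr0 // -e rep_bracket ?chev_tr0 //.
by rewrite linearB /= !trmx_mul.
Qed.

(** The sum of the eigenspaces is invariant, since each [chev C k] shifts the eigenvalue by [r k].
    It is nonzero over an algebraically closed field, hence everything by irreducibility. *)
Lemma rep_diagonalizable (H : 'M[C]_3) (r : 'I_8 -> C) : \tr H = 0 ->
  (forall k, H *m chev C k - chev C k *m H = r k *: chev C k) ->
  diagonalizable (phi H)^T.
Proof.
move=> trH Hk; set A := (phi H)^T.
have [rs0 rsE] := closed_field_poly_normal (char_poly A).
pose rs := undup rs0.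
pose W := (\sum_(i < size rs) eigenspace A rs`_i)%MS.
(* This holds for every scalar: an eigenspace for a non-root of the characteristic polynomial is
   zero. Shifted eigenvalues thus need no check. *)
have eigW a : (eigenspace A a <= W)%MS.
  have [->|nz] := eqVneq (eigenspace A a) 0; first exact: sub0mx.
  have : a \in rs.
    have : eigenvalue A a by [].
    rewrite eigenvalue_root_char rsE (monicP (char_poly_monic _)) scale1r.
    by rewrite root_prod_XsubC mem_undup.
  by rewrite -index_mem => lt_i; rewrite -{1}(nth_index 0 (_ : a \in rs)) -?index_mem //;
     apply: (sumsmx_sup (Ordinal lt_i)).
have Winv k : (W *m (phi (chev C k))^T <= W)%MS.
  rewrite sumsmxMr; apply/sumsmx_subP => i _.
  apply: submx_trans (eigW (rs`_i + r k)); apply/eigenspaceP.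
  have /eigenspaceP eA := submx_refl (eigenspace A rs`_i).
  have := rep_tr_bracket trH (Hk k); rewrite -/A => /(canRL (subrK _)) e.
  by rewrite -mulmxA e mulmxDr mulmxA eA -scalemxAl -scalemxAr addrC scalerDl.
have [W0|Wfull] := irr_chev Winv.
  have : exists a, root (char_poly A) a.
    by apply/closed_rootP; rewrite size_char_poly; case: (n) irr.1.
  case=> a; rewrite -eigenvalue_root_char /eigenvalue => /negP[].
  by rewrite -submx0 -W0 eigW.
apply/diagonalizablePeigen; exists rs; first exact: undup_uniq.
rewrite (big_nth 0) big_mkord; apply/eqmxP; rewrite submx1 /=.
by rewrite sub1mx.
Qed.

Lemma weight_basis : exists P : 'M[C]_n, exists d1 d2 : 'rV[C]_n,
  [/\ P \in unitmx, P *m (phi (H1 C))^T = diag_mx d1 *m P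
    & P *m (phi (H2 C))^T = diag_mx d2 *m P].
Proof.
have [] := codiagonalizableP [:: (phi (H1 C))^T; (phi (H2 C))^T].
(* [H2] is [chev C 1], on which [H1] acts with eigenvalue 0. *)
have comm12 : comm_mx (phi (H1 C))^T (phi (H2 C))^T.
  have := @rep_tr_bracket (H1 C) 1 (root_ev1 1) tr_H1 (bracket_H1 1).
  have -> : chev C 1 = H2 C by [].
  have -> : root_ev1 1 = 0 by rewrite /root_ev1 /= mulr0 subrr.
  by rewrite scale0r => /subr0_eq e; rewrite /comm_mx e.
case=> [|P Pu /= /and3P[/similar_diagPex[d1 /(similarP Pu) e1]
  /similar_diagPex[d2 /(similarP Pu) e2] _] _].
  split.
    move: comm12; rewrite /comm_mx => e A B; rewrite !inE.
    by move=> /orP[]/eqP-> /orP[]/eqP->; rewrite ?e.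
  move=> A; rewrite !inE => /orP[] /eqP->.
    exact: rep_diagonalizable tr_H1 bracket_H1.
  exact: rep_diagonalizable tr_H2 bracket_H2.
by exists P, d1, d2.
Qed.

End Weights.

(** * The multiset of weights in a simultaneous eigenbasis *)

Section WeightBasis.
Variable C : numClosedFieldType.
Variables (n : nat) (phi : 'M[C]_3 -> 'M[C]_n) (P : 'M[C]_n) (d1 d2 : 'rV[C]_n).
Hypothesis rep : is_sl3_rep phi.
Hypothesis Pu : P \in unitmx.
Hypothesis PH1 : P *m (phi (H1 C))^T = diag_mx d1 *m P.
Hypothesis PH2 : P *m (phi (H2 C))^T = diag_mx d2 *m P.

Let w (i : 'I_n) : weight C := (d1 0 i, d2 0 i).
Let ws := [seq w i | i <- enum 'I_n].

Let diag_vec (g : 'rV[C]_n) (d : 'rV[C]_n) j : (g *m diag_mx d) 0 j = g 0 j * d 0 j.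
Proof.
rewrite mxE (bigD1 j) //= big1 ?addr0; first by rewrite !mxE eqxx mulr1n.
by move=> k kj; rewrite !mxE (negPf kj) mulr0n mulr0.
Qed.

(** In coordinates with respect to the rows of [P] the Cartan subalgebra acts diagonally, so a
    nonzero coordinate of an eigenvector fixes the eigenvalues. *)
Lemma weight_vector_coord (v : 'rV[C]_n) (nu : weight C) j :
  v *m (phi (H1 C))^T = nu.1 *: v -> v *m (phi (H2 C))^T = nu.2 *: v ->
  (v *m invmx P) 0 j != 0 -> w j = nu.
Proof.
move=> e1 e2; set g := v *m invmx P => gj.
have vE : v = g *m P by rewrite /g mulmxKV.
clearbody g.
have gd A d a : P *m A = diag_mx d *m P -> v *m A = a *: v -> d 0 j = a.
  move=> PA vA; have := congr1 (fun u : 'rV_n => (u *m invmx P) 0 j) vA.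
  rewrite vE -mulmxA PA mulmxA mulmxK // diag_vec -scalemxAl mulmxK // mxE mulrC.
  exact: (mulIf gj).
by rewrite /w (gd _ _ _ PH1 e1) (gd _ _ _ PH2 e2); case: nu {e1 e2}.
Qed.

(** By [weight_vector_coord] the weight space is spanned by the rows of [P] of weight [nu], and
    these are linearly independent. *)
Lemma wmultE (nu : weight C) : wmult phi nu = count_mem nu ws.
Proof.
pose I := [set i | w i == nu]; pose f (i : 'I_#|I|) : 'I_n := enum_val i.
have -> : count_mem nu ws = #|I|.
  by rewrite count_map -sum1_count -sum1_card big_enum_cond /=;
    apply: eq_bigl => i; rewrite !inE.
have <- : \rank (rowsub f P) = #|I|.
  by apply/eqP; apply: row_free_rowsub => //; apply: enum_val_inj.
rewrite /wmult; apply: eqmx_rank; apply/andP; split.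
  set K := (_ :&: _)%MS.
  have K1 : K *m (phi (H1 C))^T = nu.1 *: K.
    have /sub_kermxP := capmxSl (kermx (phi (H1 C) - nu.1%:M)^T)
      (kermx (phi (H2 C) - nu.2%:M)^T).
    by rewrite -/K linearB /= mulmxBr tr_scalar_mx mul_mx_scalar => /subr0_eq.
  have K2 : K *m (phi (H2 C))^T = nu.2 *: K.
    have /sub_kermxP := capmxSr (kermx (phi (H1 C) - nu.1%:M)^T)
      (kermx (phi (H2 C) - nu.2%:M)^T).
    by rewrite -/K linearB /= mulmxBr tr_scalar_mx mul_mx_scalar => /subr0_eq.
  apply/row_subP => i.
  have -> : row i K = (row i K *m invmx P) *m P by rewrite mulmxKV.
  rewrite mulmx_sum_row; apply: summx_sub => j _.
  have [->|nz] := eqVneq ((row i K *m invmx P) 0 j) 0; first by rewrite scale0r sub0mx.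
  have wj : w j = nu.
    by apply: weight_vector_coord nz; rewrite -row_mul ?K1 ?K2 linearZ.
  have jI : j \in I by rewrite inE wj.
  apply: scalemx_sub; rewrite -(enum_rankK_in jI jI).
  have -> : row (enum_val (enum_rank_in jI j)) P = row (enum_rank_in jI j) (rowsub f P).
    by apply/rowP => k; rewrite !mxE.
  exact: row_sub.
have ker A d a : P *m A = diag_mx d *m P -> (forall i, d 0 (f i) = a) ->
    (rowsub f P <= kermx (A - a%:M))%MS.
  move=> PA da; apply/sub_kermxP; rewrite mulmxBr mul_rowsub_mx PA mul_mx_scalar.
  apply/matrixP => i j; rewrite !mxE (bigD1 (f i)) //= big1 => [|k ki].
    by rewrite !mxE eqxx mulr1n da addr0 subrr.
  by rewrite !mxE eq_sym (negPf ki) mulr0n mul0r.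
have wf i : w (f i) = nu by have := enum_valP i; rewrite inE => /eqP.
rewrite sub_capmx !linearB /= !tr_scalar_mx (ker _ _ _ PH1) ?(ker _ _ _ PH2) // => i.
  by have := congr1 snd (wf i).
by have := congr1 fst (wf i).
Qed.

Lemma det_rep_diag z (t : 'I_3 -> C) : t i0 + t i1 + t i2 = 0 ->
  \det (z%:M + phi (diag_mx (\row_i t i))) = \prod_(nu <- ws) (z + wev nu t).
Proof.
move=> t0; rewrite diag_H1H2 // repD ?mxtraceZ ?tr_H1 ?tr_H2 ?mulr0 //.
rewrite !repZ ?tr_H1 ?tr_H2 //.
pose d := \row_i (z + wev (w i) t).
have e : P *m (z%:M + (t i0 *: phi (H1 C) + (t i0 + t i1) *: phi (H2 C)))^T = diag_mx d *m P.
  have -> : (z%:M + (t i0 *: phi (H1 C) + (t i0 + t i1) *: phi (H2 C)))^T =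
      z%:M + (t i0 *: (phi (H1 C))^T + (t i0 + t i1) *: (phi (H2 C))^T).
    by rewrite !linearD /= tr_scalar_mx; congr (_ + (_ + _)); rewrite linearZ.
  rewrite !mulmxDr -!scalemxAr PH1 PH2.
  rewrite mul_mx_scalar -mul_scalar_mx !scalemxAl -!mulmxDl; congr (_ *m _).
  apply/matrixP => i j; rewrite !mxE /wev /=; case: eqP => _; rewrite ?mulr1n ?mulr0n; ring.
rewrite -det_tr; have := congr1 determinant e; rewrite !det_mulmx mulrC.
have detP : \det P != 0 by move: Pu; rewrite unitmxE unitfE.
move=> /(mulIf detP)->; rewrite det_diag big_map big_enum.
by apply: eq_bigr => i _; rewrite mxE.
Qed.

(** Permuting the diagonal of [diag_mx t] is conjugation by a permutation matrix, which preserves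
    the determinant. Its roots in [z] are the negated weight values, and at a generic [t] these
    values determine the weights. *)
Lemma weights_weyl_perm s : perm_eq ws [seq weyl_act s nu | nu <- ws].
Proof.
have [t t0 tinj] := generic_theta (ws ++ [seq weyl_act s nu | nu <- ws]).
apply: perm_map_inj_in tinj _.
suff : perm_eq [seq - wev nu t | nu <- ws]
    [seq - wev nu t | nu <- [seq weyl_act s nu | nu <- ws]].
  by move=> /(perm_map -%R); rewrite -!map_comp; under eq_map do rewrite /= opprK;
     under [X in perm_eq _ X]eq_map do rewrite /= opprK.
apply: prod_XsubC_eq; apply: poly_eval_inj => z.
rewrite !big_map !horner_prod.
under eq_bigr do rewrite !hornerE opprK.
under [RHS]eq_bigr do rewrite !hornerE opprK.
have t0' : t (s i0) + t (s i1) + t (s i2) = 0.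
  rewrite -(sum3E (fun i => t (s i))) -[RHS]t0 -(sum3E t).
  by rewrite [RHS](reindex_inj (@perm_inj _ s)).
transitivity (\det (z%:M + phi (diag_mx (\row_i t i)))).
  by rewrite det_rep_diag // !big_map.
have -> : \det (z%:M + phi (diag_mx (\row_i t i))) =
          \det (z%:M + phi (diag_mx (\row_i t (s i)))).
  have -> : diag_mx (\row_i t (s i)) = perm_mx s *m diag_mx (\row_i t i) *m invmx (perm_mx s).
    apply: (canRL (mulmxK (unitmx_perm _ _))).
    apply/matrixP => i j; rewrite -row_permE !mxE (bigD1 i) //= big1 => [|k ki]; last first.
      by rewrite !mxE eq_sym (negPf ki) mulr0n mul0r.
    by rewrite !mxE eqxx mulr1n addr0 mulr_natr.
  by rewrite det_rep_conj ?unitmx_perm // trace3E !mxE.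
rewrite det_rep_diag // !big_map; apply: eq_bigr => i _.
by rewrite wev_weyl.
Qed.

Hypothesis irr : irreducible_rep phi.
Variable lam : weight C.
Hypothesis hw : highest_weight phi lam.

Lemma highest_weight_mem : lam \in ws.
Proof.
have [v [v0 [e1 [e2 _]]]] := hw.
have [j gj] : exists j, (v^T *m invmx P) 0 j != 0.
  apply/existsP; apply: contraR v0; rewrite negb_exists => /forallP g0.
  have : v^T *m invmx P = 0
    by apply/rowP => j; rewrite [RHS]mxE; apply/eqP; move: (g0 j); rewrite negbK.
  by move=> /(congr1 (mulmx^~ P)); rewrite mulmxKV // mul0mx => /(congr1 trmx);
      rewrite trmxK trmx0 => ->.
apply/mapP; exists j; first by rewrite mem_enum.
by apply/esym; apply: weight_vector_coord gj; rewrite -trmx_mul ?e1 ?e2 linearZ.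
Qed.

(* The weight vectors that can be reached from a highest weight vector along
   nonzero matrix entries of the [chev k] span a submodule. *)
Lemma weights_in_root_coset nu : nu \in ws -> exists a b : int,
  nu = (lam.1 + (2 * a%:~R - b%:~R), lam.2 + (2 * b%:~R - a%:~R)).
Proof.
pose X k := P *m (phi (chev C k))^T *m invmx P.
pose adj := [rel i j | [exists k, X k i j != 0]].
have /mapP[j0 _ lamE] := highest_weight_mem.
pose I := connect adj j0.
pose D : 'M[C]_n := diag_mx (\row_i (I i)%:R).
have XE k : P *m (phi (chev C k))^T = X k *m P by rewrite /X mulmxKV.
clearbody X.
(* A nonzero entry [(i, j)] of [X k] forces the weight of [j] to be that of [i] plus the root of
   [chev C k]. *)
have shift A d k r : P *m A = diag_mx d *m P ->
    (phi (chev C k))^T *m A - A *m (phi (chev C k))^T = r *: (phi (chev C k))^T ->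
    forall i j, X k i j != 0 -> d 0 j = d 0 i + r.
  move=> PA e i j nz.
  have := congr1 (fun M : 'M_n => (P *m M *m invmx P) i j) e.
  rewrite mulmxBr !mulmxA XE PA -!(mulmxA _ P) PA XE mulmxBl !mulmxA !mulmxK //.
  rewrite -scalemxAr -scalemxAl XE mulmxK // !mxE (bigD1 j) //= big1 => [|l lj]; last first.
    by rewrite !mxE (negPf lj) mulr0n mulr0.
  rewrite (bigD1 i) //= big1 => [|l li]; last first.
    by rewrite !mxE eq_sym (negPf li) mulr0n mul0r.
  rewrite !mxE !eqxx !mulr1n !addr0 => e'.
  apply: (mulfI nz); rewrite mulrDr [X in _ = _ + X]mulrC -e' [X k i j * d 0 i]mulrC.
  by rewrite [RHS]addrC subrK.
have X_root k i j : X k i j != 0 -> I i -> I j.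
  by move=> nz Ii; apply: (connect_trans Ii); apply/connect1/existsP; exists k.
have inv k : (D *m P *m (phi (chev C k))^T <= D *m P)%MS.
  have -> : D *m P *m (phi (chev C k))^T = (D *m X k) *m (D *m P).
    rewrite -mulmxA XE !mulmxA; congr (_ *m _).
    apply/matrixP => i j; rewrite [RHS]mxE (bigD1 j) //= big1 => [|l lj]; last first.
      by rewrite [X in _ * X]mxE !mxE (negPf lj) mulr0n mulr0.
    rewrite addr0 [D j j]mxE mxE eqxx mulr1n.
    rewrite mxE (bigD1 i) //= big1 => [|l li]; last first.
      by rewrite mxE eq_sym (negPf li) mulr0n mul0r.
    rewrite addr0 !mxE eqxx mulr1n.
    case Ii : (I i); rewrite ?mul0r // mul1r.
    have [->|nz] := eqVneq (X k i j) 0; first by rewrite mul0r.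
    by rewrite (X_root _ _ _ nz Ii) mulr1.
  exact: submxMl.
(* The span is nonzero because it contains the row [j0], so it is everything; then [D] is invertible
   and every index is reachable from [j0]. *)
have [DP0|] := irr_chev rep irr inv.
  have D0 : D = 0 by rewrite -[D](mulmxK Pu) DP0 mul0mx.
  have /matrixP/(_ j0 j0) := D0; rewrite !mxE eqxx mulr1n => /eqP.
  by rewrite /I connect0 oner_eq0.
rewrite row_full_unit unitmx_mul => /andP[+ _]; rewrite unitmxE det_diag unitfE.
move=> /prodf_neq0 Dn /mapP[i _ ->].
have /connectP[p] : I i by have := Dn i isT; rewrite mxE; case: (I i); rewrite // eqxx.
elim/last_ind: p i => [|p j IHp] i /=.
  by move=> _ ->; exists 0, 0; rewrite -lamE mulr0 subrr !addr0; case: (lam).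
rewrite rcons_path last_rcons => /andP[/IHp/(_ erefl)[a [b wE]] /existsP[k nz]] ->.
exists (a + (root_coord k).1), (b + (root_coord k).2).
rewrite /w (shift _ _ _ _ PH1 (rep_tr_bracket rep (tr_H1 C) (bracket_H1 C k)) _ _ nz).
rewrite (shift _ _ _ _ PH2 (rep_tr_bracket rep (tr_H2 C) (bracket_H2 C k)) _ _ nz).
move: wE; rewrite /w => -[-> ->]; rewrite /root_ev1 /root_ev2 !intrD.
by congr (_, _); ring.
Qed.

End WeightBasis.

(** * Weyl orbits *)

Lemma perm_pair_exists (T : finType) (a b x y : T) :
  a != b -> x != y -> exists s : {perm T}, s a = x /\ s b = y.
Proof.
move=> ab xy; exists (tperm a x * tperm (tperm a x b) y)%g; rewrite !permM tpermL tpermL.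
split=> //; rewrite tpermD // 1?eq_sym //.
by rewrite -{1}(tpermL a x) (inj_eq perm_inj).
Qed.

Section Orbits.
Variable C : numClosedFieldType.
Implicit Types mu nu : weight C.

Lemma weyl_orbitP mu nu : reflect (exists s, nu = weyl_act s mu) (nu \in weyl_orbit mu).
Proof.
rewrite mem_undup; apply: (iffP mapP) => [[s _ ->]|[s ->]]; exists s => //.
by rewrite mem_enum inE.
Qed.

(** The order is reversed because the diagonal is precomposed with [s] and then with [t], and
    [(t * s)%g] sends [i] to [s (t i)]. *)
Lemma weyl_actM s t mu : weyl_act s (weyl_act t mu) = weyl_act (t * s)%g mu.
Proof.
have tr0 (H : 'M[C]_3) : \tr H = 0 ->
    H (s i0) (s i0) + H (s i1) (s i1) + H (s i2) (s i2) = 0.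
  move=> trH; rewrite -(sum3E (fun i => H (s i) (s i))) -[RHS]trH /mxtrace.
  by rewrite [RHS](reindex_inj (@perm_inj _ s)).
by congr (_, _); rewrite wev_weyl ?tr0 ?tr_H1 ?tr_H2 // /wev !permM.
Qed.

Lemma weyl_act1 mu : weyl_act 1%g mu = mu.
Proof.
by case: mu => a b; rewrite /weyl_act /wev !perm1 !mxE /=; congr (_, _); ring.
Qed.

Lemma weyl_orbit_refl mu : mu \in weyl_orbit mu.
Proof. by apply/weyl_orbitP; exists 1%g; rewrite weyl_act1. Qed.

(** One image for each element of the Weyl group, with repetitions when the stabilizer is
    nontrivial; in general only membership matches [weyl_orbit]. *)
Definition orbit6 (a b : C) : seq (weight C) :=
  [:: (a, b); (- a, a + b); (a + b, - b); (b, - a - b); (- a - b, a); (- b, - a)].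

Lemma mem_weyl_orbit a b nu : (nu \in weyl_orbit (a, b)) = (nu \in orbit6 a b).
Proof.
have act (s : 'S_3) x y : s i0 = x -> s i1 = y -> weyl_act s (a, b) =
    (a * H1 C x x + b * (H1 C x x + H1 C y y), a * H2 C x x + b * (H2 C x x + H2 C y y)).
  by move=> <- <-.
have a01 (s : 'S_3) : s i0 = i0 -> s i1 = i1 -> weyl_act s (a, b) = (a, b).
  by move=> /act e /e ->; rewrite !mxE /=; congr (_, _); ring.
have a10 (s : 'S_3) : s i0 = i1 -> s i1 = i0 -> weyl_act s (a, b) = (- a, a + b).
  by move=> /act e /e ->; rewrite !mxE /=; congr (_, _); ring.
have a02 (s : 'S_3) : s i0 = i0 -> s i1 = i2 -> weyl_act s (a, b) = (a + b, - b).
  by move=> /act e /e ->; rewrite !mxE /=; congr (_, _); ring.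
have a20 (s : 'S_3) : s i0 = i2 -> s i1 = i0 -> weyl_act s (a, b) = (b, - a - b).
  by move=> /act e /e ->; rewrite !mxE /=; congr (_, _); ring.
have a12 (s : 'S_3) : s i0 = i1 -> s i1 = i2 -> weyl_act s (a, b) = (- a - b, a).
  by move=> /act e /e ->; rewrite !mxE /=; congr (_, _); ring.
have a21 (s : 'S_3) : s i0 = i2 -> s i1 = i1 -> weyl_act s (a, b) = (- b, - a).
  by move=> /act e /e ->; rewrite !mxE /=; congr (_, _); ring.
apply/weyl_orbitP/idP => [[s ->]|].
  have nn x : s i0 = x -> s i1 <> x by move=> <- /perm_inj.
  case: (ord3P (s i0)) => s0; case: (ord3P (s i1)) => s1;
  do ?[by case: (nn _ s0)];
  first [rewrite (a01 _ s0 s1) | rewrite (a10 _ s0 s1) | rewrite (a02 _ s0 s1)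
        |rewrite (a20 _ s0 s1) | rewrite (a12 _ s0 s1) | rewrite (a21 _ s0 s1)];
  by rewrite !inE eqxx ?orbT.
have ex x y := @perm_pair_exists _ i0 i1 x y isT.
rewrite !inE => /or4P[/eqP->|/eqP->|/eqP->|/or3P[]/eqP->].
- by have [s [s0 s1]] := ex i0 i1 isT; exists s; rewrite a01.
- by have [s [s0 s1]] := ex i1 i0 isT; exists s; rewrite a10.
- by have [s [s0 s1]] := ex i0 i2 isT; exists s; rewrite a02.
- by have [s [s0 s1]] := ex i2 i0 isT; exists s; rewrite a20.
- by have [s [s0 s1]] := ex i1 i2 isT; exists s; rewrite a12.
- by have [s [s0 s1]] := ex i2 i1 isT; exists s; rewrite a21.
Qed.

Definition int_weight (a b : int) : weight C := (a%:~R, b%:~R).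

Lemma int_weight_inj a b a' b' : int_weight a b = int_weight a' b' -> a = a' /\ b = b'.
Proof. by case=> /intr_inj -> /intr_inj ->. Qed.

Lemma orbit6_int (a b : int) :
  orbit6 a%:~R b%:~R = [:: int_weight a b; int_weight (- a) (a + b); int_weight (a + b) (- b);
    int_weight b (- a - b); int_weight (- a - b) a; int_weight (- b) (- a)].
Proof. by rewrite /int_weight !intrD !mulrNz. Qed.

Lemma dominant_int mu : dominant mu <->
  exists a b : int, [/\ 0 <= a, 0 <= b & mu = int_weight a b].
Proof.
split=> [[a [b ->]]|[a [b [a0 b0 ->]]]]; first by exists a, b.
by exists `|a|%N, `|b|%N; rewrite /int_weight -{1}(gez0_abs a0) -{1}(gez0_abs b0).
Qed.

(** Each of the six images gives a linear system over the integers, whose nonnegative solutions all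
    have [nu = mu]. *)
Lemma dominant_orbit_eq mu nu : dominant mu -> dominant nu -> nu \in weyl_orbit mu -> nu = mu.
Proof.
move=> /dominant_int[a [b [a0 b0 ->]]] /dominant_int[c [d [c0 d0 ->]]].
rewrite mem_weyl_orbit orbit6_int !inE.
by do ?[case/orP]; move=> /eqP/int_weight_inj[e1 e2]; congr int_weight; lia.
Qed.

Lemma int_weight_dominant a b :
  exists2 mu, dominant mu & int_weight a b \in weyl_orbit mu.
Proof.
have pick (c d : int) : 0 <= c -> 0 <= d -> int_weight a b \in orbit6 c%:~R d%:~R ->
    exists2 mu, dominant mu & int_weight a b \in weyl_orbit mu.
  move=> c0 d0 ab; exists (int_weight c d); first by apply/dominant_int; exists c, d.
  by rewrite mem_weyl_orbit.
(* The signs of [a], [b] and [a + b] tell the Weyl chamber; two of the eight combinations are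
   contradictory. *)
have [a0|a0] := leP 0 a; have [b0|b0] := leP 0 b; have [ab|ab] := leP 0 (a + b); try lia.
- by apply: (pick a b) => //; rewrite !inE eqxx.
- apply: (pick (a + b) (- b)) => //; first lia.
  by rewrite orbit6_int !inE opprK addrK eqxx !orbT.
- apply: (pick (- a - b) a); [lia|lia|].
  rewrite orbit6_int !inE (_ : - (- a - b) - a = b) ?eqxx ?orbT //; lia.
- apply: (pick (- a) (a + b)); [lia|lia|].
  by rewrite orbit6_int !inE opprK (_ : - a + (a + b) = b) ?eqxx ?orbT //; lia.
- apply: (pick b (- a - b)); [lia|lia|].
  by rewrite orbit6_int !inE (_ : - b - (- a - b) = a) ?eqxx ?orbT //; lia.
- apply: (pick (- b) (- a)); [lia|lia|].
  by rewrite orbit6_int !inE !opprK eqxx !orbT.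
Qed.

(** Multiplicity is constant on orbits, and every orbit of integral weights contains exactly one
    dominant weight, so the orbits of [mus] partition the distinct elements of [ws]. *)
Lemma prod_weyl_orbits (R : comPzRingType) (F : weight C -> R) (ws mus : seq (weight C)) :
  (forall s, perm_eq ws [seq weyl_act s nu | nu <- ws]) ->
  (forall nu, nu \in ws -> exists a b, nu = int_weight a b) ->
  uniq mus -> (forall mu, mu \in mus <-> dominant mu /\ (0 < count_mem mu ws)%N) ->
  \prod_(nu <- ws) F nu =
  \prod_(mu <- mus) (\prod_(nu <- weyl_orbit mu) F nu) ^+ count_mem mu ws.
Proof.
move=> wsW wsI umus musE.
have count_le s nu : (count_mem nu ws <= count_mem (weyl_act s nu) ws)%N.
  rewrite [leqRHS](seq.permP (wsW s)) count_map; apply: sub_count => x /= /eqP->; exact: eqxx.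
(* Equality comes from the inequality for [s] and for its inverse. *)
have count_orbit mu nu : nu \in weyl_orbit mu -> count_mem nu ws = count_mem mu ws.
  case/weyl_orbitP => s ->; apply/eqP; rewrite eqn_leq count_le andbT.
  by rewrite -{2}(weyl_act1 mu) -(mulgV s) -weyl_actM count_le.
have orbit_inj mu mu' nu : dominant mu -> dominant mu' ->
    nu \in weyl_orbit mu -> nu \in weyl_orbit mu' -> mu = mu'.
  move=> dmu dmu' /weyl_orbitP[s ->] /weyl_orbitP[t e].
  apply: dominant_orbit_eq => //; apply/weyl_orbitP; exists (t * s^-1)%g.
  by rewrite -weyl_actM -e weyl_actM mulgV weyl_act1.
rewrite -big_undup_iterop_count.
have -> : \prod_(mu <- mus) (\prod_(nu <- weyl_orbit mu) F nu) ^+ count_mem mu ws =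
    \prod_(nu <- flatten [seq weyl_orbit mu | mu <- mus]) F nu ^+ count_mem nu ws.
  rewrite big_flatten big_map; apply: eq_bigr => mu _; rewrite -prodrXl.
  by rewrite big_seq [RHS]big_seq; apply: eq_bigr => nu /count_orbit->.
transitivity (\prod_(nu <- undup ws) F nu ^+ count_mem nu ws) => //.
apply: perm_big; apply: uniq_perm; first exact: undup_uniq.
  have : {in mus, forall mu, dominant mu} by move=> mu /musE[].
  elim: (mus) umus => //= mu ms IH /andP[mu_ms ums] dom.
  rewrite cat_uniq undup_uniq IH //=; last first.
    by move=> x xs; apply: dom; rewrite inE xs orbT.
  rewrite andbT; apply/hasPn => nu /flattenP[o /mapP[mu' mu's ->] nu'].
  apply: contra mu_ms => numu; rewrite (orbit_inj mu mu' nu) //;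
    by apply: dom; rewrite inE ?eqxx ?mu's ?orbT.
move=> nu; rewrite mem_undup; apply/idP/flattenP => [nuws|[o /mapP[mu mus_mu ->] numu]].
  have [a [b nuE]] := wsI _ nuws.
  have [mu dmu] := int_weight_dominant a b; rewrite -nuE => numu.
  exists (weyl_orbit mu) => //; apply: map_f; apply/musE; split=> //.
  by rewrite -(count_orbit _ _ numu) -has_count has_pred1.
have [_] := (musE mu).1 mus_mu.
by rewrite -(count_orbit _ _ numu) -has_count has_pred1.
Qed.

End Orbits.

(** * Integrality of the weights *)

Section WeightsOfRep.
Variable C : numClosedFieldType.
Variables (n : nat) (phi : 'M[C]_3 -> 'M[C]_n) (lam : weight C).
Hypothesis rep : is_sl3_rep phi.
Hypothesis irr : irreducible_rep phi.
Hypothesis hw : highest_weight phi lam.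

Lemma weights_of_rep : exists ws : seq (weight C),
  [/\ forall nu, wmult phi nu = count_mem nu ws,
      forall z (t : 'I_3 -> C), t i0 + t i1 + t i2 = 0 ->
        \det (z%:M + phi (diag_mx (\row_i t i))) = \prod_(nu <- ws) (z + wev nu t),
      forall s, perm_eq ws [seq weyl_act s nu | nu <- ws]
    & forall nu, nu \in ws -> exists a b, nu = int_weight C a b].
Proof.
have [P [d1 [d2 [Pu PH1 PH2]]]] := weight_basis rep irr.
have wsW := weights_weyl_perm rep Pu PH1 PH2.
have coset := weights_in_root_coset rep Pu PH1 PH2 irr hw.
have lam_ws := highest_weight_mem Pu PH1 PH2 hw.
set ws := map _ _ in wsW coset lam_ws.
exists ws; split=> //; [exact: wmultE Pu PH1 PH2|exact: det_rep_diag rep Pu PH1 PH2|].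
have orb nu : nu \in weyl_orbit lam -> nu \in ws.
  by case/weyl_orbitP => s ->; rewrite (perm_mem (wsW s)) map_f.
(* The two simple reflections of [lam] are weights, hence differ from [lam] by root lattice
   elements. In each case the coordinate that is not negated gives an integer without dividing by
   2. *)
have [l1 [l2 lamE]] : exists a b, lam = int_weight C a b.
  have lE : lam = (lam.1, lam.2) by case: (lam).
  have /coset[a [b [_ e]]] : (- lam.1, lam.1 + lam.2) \in ws.
    by apply: orb; rewrite {3}lE mem_weyl_orbit !inE eqxx orbT.
  have /coset[a' [b' [e' _]]] : (lam.1 + lam.2, - lam.2) \in ws.
    by apply: orb; rewrite {3}lE mem_weyl_orbit !inE eqxx !orbT.
  exists (2 * b - a), (2 * a' - b'); rewrite lE /int_weight !intrB !intrM.
  by congr (_, _); [apply: (addIr lam.2); rewrite e addrC|apply: (addrI lam.1)].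
move=> nu /coset[a [b ->]]; exists (l1 + (2 * a - b)), (l2 + (2 * b - a)).
by rewrite lamE /int_weight /= !intrD !intrM !mulrNz.
Qed.

End WeightsOfRep.

(** * Orbital factors *)

Section OrbitalFactors.
Variable C : numClosedFieldType.
Implicit Types mu nu : weight C.

Lemma meval_var (k : 'I_8) z (x : 'I_8 -> C) : ('X_(var k) : {mpoly C[9]}).@[pt z x] = x k.
Proof. by rewrite mevalXU /pt /var liftK. Qed.

Lemma meval_X0 z (x : 'I_8 -> C) : ('X_ord0 : {mpoly C[9]}).@[pt z x] = z.
Proof. by rewrite mevalXU /pt unlift_none. Qed.

Definition gen_sl3 : 'M[{mpoly C[9]}]_3 :=
  \sum_(k < 8) 'X_(var k) *: map_mx (@mpolyC 9 C) (chev C k).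

Lemma meval_gen_sl3 z x : map_mx (meval (pt z x)) gen_sl3 = sl3_of x.
Proof.
rewrite /gen_sl3 /sl3_of raddf_sum; apply: eq_bigr => k _ /=.
by rewrite map_mxZ /= meval_var; congr (_ *: _); apply/matrixP => i j; rewrite !mxE mevalC.
Qed.

(** A quadratic polynomial evaluated at [L]. Its determinant is the product of the values at the
    eigenvalues, which turns symmetric products over eigenvalues into polynomials in the entries. *)
Definition quad_mx (R : comPzRingType) (c0 c1 c2 : R) (L : 'M[R]_3) : 'M[R]_3 :=
  c0%:M + c1 *: L + c2 *: (L *m L).

Lemma det_quad_mx (c0 c1 c2 : C) (th : 'I_3 -> C) (P : 'M[C]_3) : P \in unitmx ->
  \det (quad_mx c0 c1 c2 (P *m diag_mx (\row_i th i) *m invmx P)) =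
  \prod_i (c0 + c1 * th i + c2 * th i ^+ 2).
Proof.
move=> Pu; set D := diag_mx _.
have -> : quad_mx c0 c1 c2 (P *m D *m invmx P) = P *m quad_mx c0 c1 c2 D *m invmx P.
  rewrite /quad_mx !mulmxDr !mulmxDl -!scalemxAr -!scalemxAl !mulmxA mulmxKV //.
  by rewrite mul_mx_scalar -scalemxAl mulmxV // scalemx1.
rewrite !det_mulmx mulrAC -det_mulmx mulmxV // det1 mul1r.
have -> : quad_mx c0 c1 c2 D = diag_mx (\row_i (c0 + c1 * th i + c2 * th i ^+ 2)).
  rewrite /quad_mx /D mulmx_diag; apply/matrixP => i j; rewrite !mxE.
  by case: eqP => _; rewrite ?mulr1n ?mulr0n; ring.
by rewrite det_diag; apply: eq_bigr => i _; rewrite mxE.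
Qed.

Lemma map_quad_mx (R S : comPzRingType) (f : {rmorphism R -> S}) c0 c1 c2 L :
  map_mx f (quad_mx c0 c1 c2 L) = quad_mx (f c0) (f c1) (f c2) (map_mx f L).
Proof. by rewrite /quad_mx !map_mxD !map_mxZ map_scalar_mx map_mxM. Qed.

Lemma dhomog_prod_ord m d (F : 'I_m -> {mpoly C[9]}) :
  (forall i, F i \is d.-homog) -> \prod_i F i \is (m * d).-homog.
Proof.
elim: m F => [|m IHm] F Fd; first by rewrite big_ord0 mul0n dhomog1.
by rewrite big_ord_recl mulSn; apply: dhomogM => //; apply: IHm.
Qed.

Lemma dhomog_det m d (A : 'M[{mpoly C[9]}]_m) :
  (forall i j, A i j \is d.-homog) -> \det A \is (m * d).-homog.
Proof.
move=> Ad; rewrite /determinant; apply: rpred_sum => s _; rewrite rpredMsign.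
exact: dhomog_prod_ord.
Qed.

Lemma dhomog_gen_sl3 i j : gen_sl3 i j \is 1.-homog.
Proof.
rewrite /gen_sl3 summxE; apply: rpred_sum => k _; rewrite !mxE mulrC mul_mpolyC.
by apply: rpredZ; rewrite dhomogX /= mdeg1.
Qed.

Lemma dhomog_X0 : ('X_ord0 : {mpoly C[9]}) \is 1.-homog.
Proof. by rewrite dhomogX /= mdeg1. Qed.

Lemma conj_theta_sum (x : 'I_8 -> C) (th : 'I_3 -> C) P : P \in unitmx ->
  sl3_of x = P *m diag_mx (\row_i th i) *m invmx P -> th i0 + th i1 + th i2 = 0.
Proof.
move=> Pu e; have := sl3_of_tr0 x; rewrite e mxtrace_mulC mulmxA mulVmx // mul1mx.
by rewrite trace3E !mxE !eqxx !mulr1n.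
Qed.

(** The orbital factor for nonzero weights on a wall, whose three conjugates take the values [c]
    times an eigenvalue. *)
Definition cubic_factor (c : C) : {mpoly C[9]} :=
  \det (quad_mx 'X_ord0 c%:MP 0 gen_sl3).

Lemma cubic_factorE c z x th P : P \in unitmx ->
  sl3_of x = P *m diag_mx (\row_i th i) *m invmx P ->
  (cubic_factor c).@[pt z x] = (z + c * th i0) * (z + c * th i1) * (z + c * th i2).
Proof.
move=> Pu e; rewrite /cubic_factor -det_map_mx map_quad_mx meval_gen_sl3 e.
rewrite /= meval_X0 mevalC meval0 det_quad_mx // !big_ord_recr big_ord0 /= mul1r.
by rewrite !mul0r !addr0;
  congr ((_ + _ * th _) * (_ + _ * th _) * (_ + _ * th _)); apply: val_inj.
Qed.

Lemma cubic_factor_homog c : cubic_factor c \is 3.-homog.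
Proof.
apply: (@dhomog_det 3 1) => i j; rewrite /quad_mx scale0r addr0 !mxE.
apply: rpredD; first by apply: rpredMn; apply: dhomog_X0.
by rewrite mul_mpolyC; apply: rpredZ; apply: dhomog_gen_sl3.
Qed.

(* If [i, j, k] are the three indices, then since the eigenvalues sum to zero
   [(z + (a + b) t_i + b t_j) (z + (a + b) t_j + b t_i)] is a polynomial in
   [z], [t_k] and [t_0^2 + t_1^2 + t_2^2]. *)
Definition sextic_factor (a b : C) : {mpoly C[9]} :=
  \det (quad_mx ('X_ord0 ^+ 2 + (- a ^+ 2 / 2)%:MP * \tr (gen_sl3 *m gen_sl3))
    ((- (a + 2 * b))%:MP * 'X_ord0) ((a ^+ 2 + a * b + b ^+ 2)%:MP) gen_sl3).

Lemma sextic_factorE a b z x th P : P \in unitmx ->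
  sl3_of x = P *m diag_mx (\row_i th i) *m invmx P ->
  (sextic_factor a b).@[pt z x] = \prod_(nu <- orbit6 a b) (z + wev nu th).
Proof.
move=> Pu e; rewrite /sextic_factor -det_map_mx map_quad_mx meval_gen_sl3.
rewrite /= rmorphD rmorphXn !rmorphM /= meval_X0 !mevalC.
have -> : (\tr (gen_sl3 *m gen_sl3)).@[pt z x] = th i0 ^+ 2 + th i1 ^+ 2 + th i2 ^+ 2.
  rewrite -trace_map_mx map_mxM /= meval_gen_sl3 e !mulmxA mulmxKV //.
  rewrite mxtrace_mulC !mulmxA mulVmx // mul1mx mulmx_diag trace3E !mxE /=.
  by rewrite !mulr1n !expr2.
have t2 : th i2 = - (th i0 + th i1) by rewrite -(addr0_eq (conj_theta_sum Pu e)).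
rewrite e det_quad_mx // big_ord_recr big_ord_recr big_ord_recr big_ord0 /= mul1r.
have [-> -> ->] : [/\ widen_ord (leqnSn 2) (widen_ord (leqnSn 1) ord_max) = i0,
   widen_ord (leqnSn 2) ord_max = i1 & (ord_max : 'I_3) = i2].
  by split; apply: val_inj.
have two0 : (2 : C) != 0 by rewrite pnatr_eq0.
rewrite /orbit6 !big_cons big_nil /wev /= t2.
move: (th i0) (th i1) => t0 t1.
(* The quadratic at each eigenvalue splits into the two orbit members exchanged by transposing the
   other two eigenvalues. *)
have -> : z ^+ 2 + - a ^+ 2 / 2 * (t0 ^+ 2 + t1 ^+ 2 + (- (t0 + t1)) ^+ 2) +
    - (a + 2 * b) * z * t0 + (a ^+ 2 + a * b + b ^+ 2) * t0 ^+ 2 =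
    (z + ((- a - b) * t0 + a * (t0 + t1))) * (z + (- b * t0 + - a * (t0 + t1))) by field.
have -> : z ^+ 2 + - a ^+ 2 / 2 * (t0 ^+ 2 + t1 ^+ 2 + (- (t0 + t1)) ^+ 2) +
    - (a + 2 * b) * z * t1 + (a ^+ 2 + a * b + b ^+ 2) * t1 ^+ 2 =
    (z + ((a + b) * t0 + - b * (t0 + t1))) * (z + (b * t0 + (- a - b) * (t0 + t1))) by field.
have -> : z ^+ 2 + - a ^+ 2 / 2 * (t0 ^+ 2 + t1 ^+ 2 + (- (t0 + t1)) ^+ 2) +
    - (a + 2 * b) * z * (- (t0 + t1)) + (a ^+ 2 + a * b + b ^+ 2) * (- (t0 + t1)) ^+ 2 =
    (z + (a * t0 + b * (t0 + t1))) * (z + (- a * t0 + (a + b) * (t0 + t1))) by field.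
ring.
Qed.

Lemma sextic_factor_homog a b : sextic_factor a b \is 6.-homog.
Proof.
have sq i j : (gen_sl3 *m gen_sl3) i j \is 2.-homog.
  rewrite mxE; apply: rpred_sum => k _.
  by apply: (@dhomogM _ _ _ 1 _ 1); apply: dhomog_gen_sl3.
have quadE c0 c1 c2 i j : quad_mx c0 c1 c2 gen_sl3 i j =
    c0 *+ (i == j) + c1 * gen_sl3 i j + c2 * (gen_sl3 *m gen_sl3) i j.
  by rewrite /quad_mx !mxE.
apply: (@dhomog_det 3 2) => i j; rewrite quadE.
apply: rpredD; first apply: rpredD.
- apply: rpredMn; apply: rpredD; first exact: (dhomogMn 2 dhomog_X0).
  by rewrite mul_mpolyC; apply: rpredZ; apply: rpred_sum => k _; apply: sq.
- apply: (@dhomogM _ _ _ 1 _ 1); last exact: dhomog_gen_sl3.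
  by rewrite mul_mpolyC; apply: rpredZ; apply: dhomog_X0.
- by rewrite mul_mpolyC; apply: rpredZ; apply: sq.
Qed.

End OrbitalFactors.

(** * Irreducibility of the orbital factors *)

Section Irreducibility.
Variable C : numClosedFieldType.
Implicit Types mu nu : weight C.

(** Moves the question of which orbit members coincide to pairs of integers, where it is linear
    arithmetic. *)
Lemma weyl_orbit_perm (a b : int) (s : seq (int * int)) :
  uniq s ->
  s =i [:: (a, b); (- a, a + b); (a + b, - b); (b, - a - b); (- a - b, a); (- b, - a)] ->
  perm_eq (weyl_orbit (int_weight C a b)) [seq int_weight C x.1 x.2 | x <- s].
Proof.
move=> us sE; apply: uniq_perm; first exact: undup_uniq.
  by rewrite map_inj_uniq // => -[x y] [x' y'] /= /int_weight_inj[-> ->].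
move=> nu; rewrite mem_weyl_orbit orbit6_int.
by rewrite (eq_mem_map (fun x => int_weight C x.1 x.2) sE).
Qed.

Lemma orbital_factor_exists mu : dominant mu ->
  exists2 p, orbital_factor mu p & p \is (size (weyl_orbit mu)).-homog.
Proof.
move=> /dominant_int[a [b [a0 b0 ->]]].
have [az|anz] := eqVneq a 0; have [bz|bnz] := eqVneq b 0.
- have pe : perm_eq (weyl_orbit (int_weight C a b))
      [seq int_weight C x.1 x.2 | x <- [:: (a, b)]].
    apply: weyl_orbit_perm => // -[x y]; rewrite az bz !inE !xpair_eqE; lia.
  exists 'X_ord0; last by rewrite (perm_size pe); apply: dhomog_X0.
  move=> z x th P Pu e; rewrite (perm_big _ pe) /= big_seq1 meval_X0.
  by rewrite /wev az bz /= !mul0r !addr0.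
- have pe : perm_eq (weyl_orbit (int_weight C a b))
      [seq int_weight C x.1 x.2 | x <- [:: (a, b); (b, - b); (- b, a)]].
    apply: weyl_orbit_perm => [|[x y]]; rewrite /= az !inE !xpair_eqE; lia.
  (* As the eigenvalues sum to zero, [b (t0 + t1) = - b t2]; hence the sign. *)
  exists (cubic_factor (- b%:~R)); last by rewrite (perm_size pe); apply: cubic_factor_homog.
  move=> z x th P Pu e; rewrite (perm_big _ pe) /= !big_cons big_nil (cubic_factorE _ _ Pu e).
  have t2 : th i2 = - (th i0 + th i1) by rewrite -(addr0_eq (conj_theta_sum Pu e)).
  by rewrite /wev az /= t2 !mulrNz; ring.
- have pe : perm_eq (weyl_orbit (int_weight C a b))
      [seq int_weight C x.1 x.2 | x <- [:: (a, b); (- a, a); (b, - a)]].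
    apply: weyl_orbit_perm => [|[x y]]; rewrite /= bz !inE !xpair_eqE; lia.
  exists (cubic_factor a%:~R); last by rewrite (perm_size pe); apply: cubic_factor_homog.
  move=> z x th P Pu e; rewrite (perm_big _ pe) /= !big_cons big_nil (cubic_factorE _ _ Pu e).
  have t2 : th i2 = - (th i0 + th i1) by rewrite -(addr0_eq (conj_theta_sum Pu e)).
  by rewrite /wev bz /= t2 !mulrNz; ring.
- have pe : perm_eq (weyl_orbit (int_weight C a b)) (orbit6 a%:~R b%:~R).
    rewrite orbit6_int.
    apply: (weyl_orbit_perm (s := [::
      (a, b); (- a, a + b); (a + b, - b); (b, - a - b); (- a - b, a); (- b, - a)])) => //.
    by rewrite /= !inE !negb_or !xpair_eqE; repeat (apply/andP; split=> //); lia.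
  exists (sextic_factor a%:~R b%:~R); last by rewrite (perm_size pe); apply: sextic_factor_homog.
  by move=> z x th P Pu e; rewrite (perm_big _ pe) (sextic_factorE _ _ _ Pu e).
Qed.

Lemma orbital_factor_unique mu p q :
  orbital_factor mu p -> orbital_factor mu q -> p = q.
Proof.
move=> fp fq; apply: eq_on_diagonalizable => z x th P Pu e.
by rewrite (fp _ _ _ _ Pu e) (fq _ _ _ _ Pu e).
Qed.

(** At [z0 = 1] and [L = 0] every factor equals 1. *)
Lemma orbital_factor_neq0 mu p : orbital_factor mu p -> p != 0.
Proof.
move=> fp; apply: contraTneq (oner_neq0 C) => p0; rewrite negbK.
have := fp 1 (fun=> 0) (fun=> 0) 1%:M (unitmx1 _ _).
rewrite p0 meval0 => ->; last first.
  rewrite /sl3_of big1 => [|k _]; last by rewrite scale0r.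
  by rewrite mul1mx invmx1 mulmx1; apply/matrixP => i j; rewrite !mxE mul0rn.
by apply/eqP; rewrite big1 // => nu _; rewrite /wev addr0 !mulr0 !addr0.
Qed.

(** By uniqueness [p] is the explicit determinant, a nonzero homogeneous polynomial of that
    degree. *)
Lemma mdegree_orbital_factor mu p : dominant mu -> orbital_factor mu p ->
  mdegree p = size (weyl_orbit mu).
Proof.
move=> dmu fp; have [q fq qh] := orbital_factor_exists dmu.
have p0 := orbital_factor_neq0 fp; move: qh; rewrite -(orbital_factor_unique fp fq) => ph.
by apply: (dhomog_uniq p0 (dhomog_msize ph) ph).
Qed.

(** Chevalley coordinates of the companion matrix of [X^3 + e2 X - e3], where [e2] and [e3] are the
    elementary symmetric functions of [th]; for [e1 = 0] its eigenvalues are the [th i]. *)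
Definition companion_coord (R : pzRingType) (th : 'I_3 -> R) (k : 'I_8) : R :=
  match val k with
  | 3 => th i0 * th i1 * th i2
  | 4 | 7 => 1
  | 5 => - (th i0 * th i1 + th i0 * th i2 + th i1 * th i2)
  | _ => 0
  end.

Lemma companion_coord_perm (th : 'I_3 -> C) (s : 'S_3) :
  companion_coord (fun i => th (s i)) =1 companion_coord th.
Proof.
have d01 : s i0 <> s i1 by move/perm_inj.
have d02 : s i0 <> s i2 by move/perm_inj.
have d12 : s i1 <> s i2 by move/perm_inj.
move=> k; rewrite /companion_coord; case: (val k) => [|[|[|[|[|[|[|[|[]]]]]]]]] //;
move: d01 d02 d12; case: (ord3P (s i0)) => ->; case: (ord3P (s i1)) => -> //;
case: (ord3P (s i2)) => -> // *; ring.
Qed.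

(* The rows [(1, t_i, t_i^2)] are left eigenvectors of the companion matrix. *)
Lemma companion_diagonalizable (th : 'I_3 -> C) :
  th i0 + th i1 + th i2 = 0 -> th i0 != th i1 -> th i0 != th i2 -> th i1 != th i2 ->
  exists2 P, P \in unitmx &
    sl3_of (companion_coord th) = P *m diag_mx (\row_i th i) *m invmx P.
Proof.
move=> t0 n01 n02 n12; have t2 : th i2 = - (th i0 + th i1) by rewrite -(addr0_eq t0).
pose V := (Vandermonde 3 (\row_i th i))^T.
have Vu : V \in unitmx.
  rewrite unitmx_tr unitmxE det_Vandermonde unitfE.
  apply/prodf_neq0 => i _; apply/prodf_neq0 => j; rewrite !mxE subr_eq0.
  by case: (ord3P i) => ->; case: (ord3P j) => -> //= _; rewrite eq_sym.
exists (invmx V); first by rewrite unitmx_inv.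
rewrite invmxK -mulmxA; apply: (canRL (mulKmx Vu)).
rewrite /sl3_of !big_ord_recr big_ord0 /= /companion_coord /chev /= !scale0r !scale1r !add0r.
apply/matrixP => i j; rewrite !mxE !sum3E !mxE.
by case: (ord3P i) => ->; case: (ord3P j) => ->; rewrite /= ?t2; ring.
Qed.

Lemma companion_orbital_factor mu p (th : 'I_3 -> C) z : orbital_factor mu p ->
  th i0 + th i1 + th i2 = 0 -> th i0 != th i1 -> th i0 != th i2 -> th i1 != th i2 ->
  p.@[pt z (companion_coord th)] = \prod_(nu <- weyl_orbit mu) (z + wev nu th).
Proof.
move=> fp t0 n01 n02 n12; have [P Pu e] := companion_diagonalizable t0 n01 n02 n12.
exact: fp Pu e.
Qed.

Lemma mpoly_unit_msize n (p : {mpoly C[n]}) : p \is a GRing.unit -> (msize p <= 1)%N.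
Proof.
move=> pu; have p0 : p != 0 by apply: contraTneq pu => ->; rewrite unitr0.
have v0 : p^-1 != 0 by rewrite invr_eq0.
have := msizeM p0 v0; rewrite divrr // msize1 (mpolySpred _ p0) (mpolySpred _ v0).
by rewrite addnS addSn /= => -[] /esym/eqP; rewrite addn_eq0 => /andP[/eqP->].
Qed.

Lemma msize_mpoly_unit n (p : {mpoly C[n]}) : p != 0 -> (msize p <= 1)%N -> p \is a GRing.unit.
Proof.
move=> p0 /msize1_polyC pE; rewrite pE; apply: rmorph_unit; rewrite unitfE.
by apply: contraNneq p0 => c0; rewrite pE c0 mpolyC0.
Qed.

(** Permuting [th] fixes the companion matrix and moves the root over the whole orbit. For generic
    [th] this gives as many distinct roots of [q] in [z0] as the degree of [p], leaving degree 0 for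
    [r]. *)
Lemma orbital_factor_cofactor_unit mu (p q r : {mpoly C[9]}) : orbital_factor mu p ->
  mdegree p = size (weyl_orbit mu) -> p = q * r ->
  (forall th : 'I_3 -> C, th i0 + th i1 + th i2 = 0 ->
     q.@[pt (- wev mu th) (companion_coord th)] = 0) ->
  r \is a GRing.unit.
Proof.
move=> fp dp pE q_root; have p0 := orbital_factor_neq0 fp.
have [q0 r0] : q != 0 /\ r != 0 by apply/andP; rewrite -negb_or -mulf_eq0 -pE.
(* The three added weights are those of the standard representation. Their values are the [th i], so
   the eigenvalues become distinct as well. *)
have [th t0 th_inj] := generic_theta (weyl_orbit mu ++ [:: (1, 0); (-1, 1); (0, -1)]).
have neq (nu nu' : weight C) : nu \in [:: (1, 0); (-1, 1); (0, -1)] ->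
    nu' \in [:: (1, 0); (-1, 1); (0, -1)] -> nu != nu' -> wev nu th != wev nu' th.
  move=> nu3 nu'3; apply: contra_neq => /th_inj; apply; rewrite mem_cat ?nu3 ?nu'3 orbT //.
have e0 : th i0 = wev (1, 0) th by rewrite /wev /=; ring.
have e1 : th i1 = wev (-1, 1) th by rewrite /wev /=; ring.
have e2 : th i2 = wev (0, -1) th.
  have -> : th i2 = - (th i0 + th i1) by rewrite -(addr0_eq t0).
  by rewrite /wev /=; ring.
have one0 := oner_neq0 C.
have n01 : th i0 != th i1.
  by rewrite e0 e1; apply: neq; rewrite ?inE ?eqxx ?orbT //;
     rewrite xpair_eqE [0 == 1]eq_sym (negPf one0) andbF.
have n02 : th i0 != th i2.
  by rewrite e0 e2; apply: neq; rewrite ?inE ?eqxx ?orbT // xpair_eqE (negPf one0).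
have n12 : th i1 != th i2.
  by rewrite e1 e2; apply: neq; rewrite ?inE ?eqxx ?orbT // xpair_eqE oppr_eq0 (negPf one0).
pose h (i : 'I_9) : {poly C} :=
  if unlift ord0 i is Some k then (companion_coord th k)%:P else 'X.
pose qz := mmap polyC h q.
have qzE z : qz.[z] = q.@[pt z (companion_coord th)].
  rewrite horner_mmap_polyC; apply: meval_eq => i; rewrite /h /pt.
  by case: unlift => [k|]; rewrite ?hornerC ?hornerX.
(* Otherwise the specialization of [p = q * r] would vanish for every [z], but it is a product of
   finitely many linear factors. *)
have qz0 : qz != 0.
  have [z zB] := exists_notin [seq - wev nu th | nu <- weyl_orbit mu].
  apply/eqP => qz0.
  have := companion_orbital_factor z fp t0 n01 n02 n12.
  rewrite pE mevalM -qzE qz0 horner0 mul0r => /esym/eqP; rewrite prodf_seq_eq0.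
  case/hasP => nu nu_mu /=; rewrite addr_eq0 => /eqP zE.
  by case/negP: zB; rewrite zE; apply: map_f.
have size_q : (size (weyl_orbit mu) < msize q)%N.
  have := @max_poly_roots _ qz [seq - wev nu th | nu <- weyl_orbit mu] qz0.
  rewrite size_map => H; apply: leq_trans (H _ _) _.
  - apply/allP => _ /mapP[nu /weyl_orbitP[s ->] ->]; apply/rootP.
    rewrite qzE wev_weyl // -[RHS](q_root (fun i => th (s i))).
      by apply: meval_eq => i; rewrite /pt; case: unlift => [k|//];
         rewrite companion_coord_perm.
    rewrite -(sum3E (fun i => th (s i))) -[RHS]t0 -(sum3E th).
    by rewrite [RHS](reindex_inj (@perm_inj _ s)).
  - rewrite map_inj_in_uniq ?undup_uniq // => nu nu' nu_mu nu'_mu /oppr_inj.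
    by apply: th_inj; rewrite mem_cat ?nu_mu ?nu'_mu.
  apply: size_mmap_polyC => i; rewrite /h; case: unlift => [k|]; rewrite ?size_polyX //.
  exact: leq_trans (size_polyC_leq1 _) _.
apply: msize_mpoly_unit => //.
move: dp size_q; rewrite /mdegree pE msizeM // (mpolySpred _ q0) (mpolySpred _ r0).
move: (msize q).-1 (msize r).-1 (size _) => x y k; lia.
Qed.

(** Substituting the root [- mu(t)] and the companion matrix of [t] sends [p] to 0 in the integral
    domain of polynomials in two free eigenvalues, so it kills one of the two factors; the other is
    then a unit. *)
Lemma orbital_factor_irreducible mu p : dominant mu -> orbital_factor mu p ->
  mirreducible p.
Proof.
move=> dmu fp; have dp := mdegree_orbital_factor dmu fp.
have p0 := orbital_factor_neq0 fp.
have orb0 : (0 < size (weyl_orbit mu))%N.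
  by have := weyl_orbit_refl mu; case: (weyl_orbit mu).
split=> //; split=> [|q r pE].
  by apply/negP => /mpoly_unit_msize; move: dp; rewrite /mdegree; lia.
pose th (i : 'I_3) : {mpoly C[2]} :=
  if i == i0 then 'X_0 else if i == i1 then 'X_1 else - ('X_0 + 'X_1).
pose tup : 9.-tuple {mpoly C[2]} := [tuple
  if unlift ord0 i is Some k then companion_coord th k
  else - (mu.1%:MP * th i0 + mu.2%:MP * (th i0 + th i1)) | i < 9].
pose tv (v : 'I_2 -> C) (i : 'I_3) := (th i).@[v].
have tv0 v : tv v i0 + tv v i1 + tv v i2 = 0 by rewrite /tv -!mevalD /th /= subrr meval0.
have tupE (f : {mpoly C[9]}) v :
    (f \mPo tup).@[v] = f.@[pt (- wev mu (tv v)) (companion_coord (tv v))].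
  rewrite comp_mpoly_meval; apply: meval_eq => i; rewrite tnth_mktuple /pt.
  case: unlift => [k|]; last by rewrite mevalN mevalD !mevalM !mevalC mevalD.
  rewrite /companion_coord; case: (val k) => [|[|[|[|[|[|[|[|[]]]]]]]]];
  by rewrite ?meval0 ?meval1 ?mevalN ?mevalD ?mevalM.
(* The value of [p] is available only where the companion matrix is known to be diagonalizable, that
   is for distinct eigenvalues; multiplying by [delta] covers the remaining points. *)
pose delta := (th i0 - th i1) * (th i0 - th i2) * (th i1 - th i2).
have delta0 : delta != 0.
  (* At the eigenvalues 1, 0, -1 the value of [delta] is 2. *)
  apply/eqP => /(congr1 (meval (fun i : 'I_2 => if i == 0 then 1 else 0))) /eqP.
  rewrite /delta /th /= !mevalM !mevalB !mevalN !mevalD !mevalXU meval0 /=.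
  rewrite (_ : _ * _ = (2 : C)); first by rewrite pnatr_eq0.
  by ring.
have : (q \mPo tup) * (r \mPo tup) * delta = 0.
  apply: meval_inj0 => v; rewrite mevalM [X in X * _]mevalM !tupE -mevalM -pE.
  rewrite /delta !mevalM !mevalB -!/(tv v _).
  have [->|n01] := eqVneq (tv v i0) (tv v i1); first by rewrite subrr !mul0r mulr0.
  have [->|n02] := eqVneq (tv v i0) (tv v i2); first by rewrite subrr mulr0 mul0r mulr0.
  have [->|n12] := eqVneq (tv v i1) (tv v i2); first by rewrite subrr !mulr0.
  rewrite (companion_orbital_factor _ fp) // (perm_big _ (perm_to_rem (weyl_orbit_refl mu))).
  by rewrite big_cons /= addNr !mul0r.
have roots (f : {mpoly C[9]}) : f \mPo tup = 0 ->
    forall t : 'I_3 -> C, t i0 + t i1 + t i2 = 0 ->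
      f.@[pt (- wev mu t) (companion_coord t)] = 0.
  move=> f0 t t0; pose v (i : 'I_2) := if i == 0 then t i0 else t i1.
  have tvE i : tv v i = t i.
    have t2 : t i2 = - (t i0 + t i1) by rewrite -(addr0_eq t0).
    by case: (ord3P i) => ->; rewrite /tv /th /= ?mevalN ?mevalD !mevalXU // t2.
  have := tupE f v; rewrite f0 meval0 => ->.
  apply: meval_eq => i; rewrite /pt /wev /companion_coord.
  by rewrite !tvE.
move/eqP; rewrite mulf_eq0 (negPf delta0) orbF mulf_eq0 => /orP[]/eqP/roots.
  by move/(orbital_factor_cofactor_unit fp dp pE); right.
by rewrite mulrC in pE; move/(orbital_factor_cofactor_unit fp dp pE); left.
Qed.

End Irreducibility.

(** * Factorization of the characteristic polynomial *)

Theorem theorem3p4 (C : numClosedFieldType) (n : nat)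
    (phi : 'M[C]_3 -> 'M[C]_n) (lam : weight C) :
  is_sl3_rep phi -> irreducible_rep phi -> highest_weight phi lam ->
  forall mus : seq (weight C),
    uniq mus ->
    (forall mu : weight C, mu \in mus <-> dominant mu /\ (0 < wmult phi mu)%N) ->
    (forall mu, mu \in mus -> exists p, orbital_factor mu p) /\
    (forall f : weight C -> {mpoly C[9]},
       (forall mu, mu \in mus -> orbital_factor mu (f mu)) ->
       char_mpoly phi = \prod_(mu <- mus) f mu ^+ wmult phi mu /\
       (forall mu, mu \in mus ->
          mirreducible (f mu) /\ mdegree (f mu) = size (weyl_orbit mu))).
Proof.
move=> rep irr hw mus umus musE; split=> [mu /musE[dmu _]|f fE].
  by have [p fp _] := orbital_factor_exists dmu; exists p.
split=> [|mu mu_mus]; last first.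
  have [dmu _] := (musE mu).1 mu_mus; have fmu := fE _ mu_mus.
  by split; [apply: orbital_factor_irreducible fmu|apply: mdegree_orbital_factor].
have [ws [multE detE wsW wsI]] := weights_of_rep rep irr hw.
(* At a diagonalizable point the left side becomes the determinant at the diagonal matrix of
   eigenvalues, a product over all weights, which is then grouped by orbits. *)
apply: eq_on_diagonalizable => z x th P Pu e.
have t0 := conj_theta_sum Pu e.
have -> : (char_mpoly phi).@[pt z x] = \det (z%:M + phi (sl3_of x)).
  rewrite /char_mpoly -det_map_mx map_mxD rep_sl3_of //; congr (\det (_ + _)).
    by rewrite map_mxZ map_mx1 /= meval_X0 scalemx1.
  rewrite raddf_sum; apply: eq_bigr => k _ /=; rewrite map_mxZ /= meval_var.
  by congr (_ *: _); apply/matrixP => i j; rewrite !mxE mevalC.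
rewrite e det_rep_conj //; last by rewrite trace3E !mxE !eqxx !mulr1n.
rewrite detE // (prod_weyl_orbits _ wsW wsI umus) => [|mu]; last by rewrite -multE; apply: musE.
rewrite rmorph_prod big_seq [RHS]big_seq; apply: eq_bigr => mu mu_mus /=.
by rewrite rmorphXn /= (fE _ mu_mus _ _ _ _ Pu e) multE.
Qed.
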